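(* Let $q=p^e$ be a power of a prime $p$ with $q\equiv 1 \pmod 6$, let $\omega$ be a generator of $\widehat{\mathbb{F}}_q^\times$, put $t=(q-1)/6$, $\omega_6:=\omega^t$, $\omega_3:=\omega^{2t}$, $\omega_2:=\omega^{3t}$. For $\lambda\in\mathbb{F}_q$ with $\lambda\neq 0$ and $\lambda^6\neq 1$, the number of $\mathbb{F}_q$-rational points of the projective hypersurface $X_\lambda^6:\ x_1^6+\cdots+x_6^6=6\lambda x_1x_2\cdots x_6$ is \begin{align*} \#X_{\lambda}^6(\mathbb{F}_q)&=\frac{q^5-1}{q-1}+360q^2\omega_2(1-\lambda^6) +q^4\, {}_5F_4\!\left(\begin{matrix}\omega_6, \omega_3, \omega_2, \overline{\omega}_3, \overline{\omega}_6\\ \epsilon, \epsilon, \epsilon, \epsilon\end{matrix}\Big|\ \tfrac{1}{\lambda^6}\right)_q\\ &+30q^3 \omega_6(-1)\, {}_3F_2\!\left(\begin{matrix}\omega_3, \omega_2, \overline{\omega}_3\\ \epsilon, \epsilon\end{matrix}\Big|\ \tfrac{1}{\lambda^6}\right)_q +30q^3\, {}_3F_2\!\left(\begin{matrix}\omega_6, \omega_2, \overline{\omega}_6\\ \epsilon, \epsilon\end{matrix}\Big|\ \tfrac{1}{\lambda^6}\right)_q\\ &-15q^3\omega_6(-1) J(\omega_2, \overline{\omega}_3,\overline{\omega}_6)\, {}_4F_3\!\left(\begin{matrix}\omega_6, \overline{\omega}_6, \overline{\omega}_3, \omega_3\\ \epsilon, \epsilon, \omega_2\end{matrix}\Big|\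 \tfrac{1}{\lambda^6}\right)_q\\ &-20q^3\omega_6(-1) J(\omega_6,\omega_3,\omega_2)\, {}_4F_3\!\left(\begin{matrix}\omega_6, \omega_2, \overline{\omega}_3, \overline{\omega}_6\\ \epsilon, \omega_3, \omega_3\end{matrix}\Big|\ \tfrac{1}{\lambda^6}\right)_q\\ &+60q^2 \omega_6(-1)J(\omega_6, \omega_6, \overline{\omega}_3)J(\omega_2,\overline{\omega}_3,\overline{\omega}_6)\, {}_3F_2\!\left(\begin{matrix}\omega_6, \overline{\omega}_3, \omega_2\\ \epsilon, \overline{\omega}_6\end{matrix}\Big|\ \tfrac{1}{\lambda^6}\right)_q\\ &+60q^2J(\omega_3,\omega_3,\omega_3)J(\omega_2, \overline{\omega}_3, \overline{\omega}_6)\, {}_3F_2\!\left(\begin{matrix}\omega_3, \overline{\omega}_6, \omega_2\\ \epsilon, \omega_6\end{matrix}\Big|\ \tfrac{1}{\lambda^6}\right)_q +90q^3\, {}_3F_2\!\left(\begin{matrix}\omega_2, \overline{\omega}_3, \overline{\omega}_6\\ \omega_6, \omega_3\end{matrix}\Big|\ \tfrac{1}{\lambda^6}\right)_q\\ &-30q^2J(\omega_6,\omega_6)J(\omega_6, \omega_3, \omega_2)\, {}_3F_2\!\left(\begin{matrix}\omega_6, \omega_2, \overline{\omega}_6\\ \omega_3, \overline{\omega}_3\end{matrix}\Big|\ \tfrac{1}{\lambda^6}\right)_q\\ &-120q^2J(\omega_6,\omega_3,\omega_2)\, {}_2F_1\!\left(\begin{matrix}\omega_6, \omega_3\\ \epsilon\end{matrix}\Big|\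 \tfrac{1}{\lambda^6}\right)_q -120q^2 J(\omega_2,\overline{\omega}_3,\overline{\omega}_6)\, {}_2F_1\!\left(\begin{matrix}\overline{\omega}_3, \overline{\omega}_6\\ \epsilon\end{matrix}\Big|\ \tfrac{1}{\lambda^6}\right)_q\\ &-180q^2J(\omega_6,\omega_3, \omega_2)\, {}_2F_1\!\left(\begin{matrix}\omega_3, \overline{\omega}_3\\ \omega_2\end{matrix}\Big|\ \tfrac{1}{\lambda^6}\right)_q -180q^2J(\omega_6,\omega_3, \omega_2)\, {}_2F_1\!\left(\begin{matrix}\omega_3, \overline{\omega}_6\\ \overline{\omega}_3\end{matrix}\Big|\ \tfrac{1}{\lambda^6}\right)_q . \end{align*} Here ${}_{n+1}F_n\!\left(\begin{matrix}A_0,\dots,A_n\\ B_1,\dots,B_n\end{matrix}\Big|\ x\right)_q$ denotes Greene's hypergeometric function as defined in the context.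
   Context: $\mathbb{F}_q$ is the finite field with $q$ elements, $\widehat{\mathbb{F}}_q^\times$ the group of multiplicative characters $\mathbb{F}_q^\times\to\mathbb{C}^\times$; every character $\chi$ (including the trivial character $\epsilon$) is extended to $\mathbb{F}_q$ by $\chi(0)=0$. $\overline{\chi}$ denotes the complex conjugate (inverse) character. Jacobi sums: $J(\chi_1,\dots,\chi_n)=\sum_{x_1+\cdots+x_n=1,\ x_i\in\mathbb{F}_q}\chi_1(x_1)\cdots\chi_n(x_n)$; in particular $J(\chi,\psi)=\sum_{x\in\mathbb{F}_q}\chi(x)\psi(1-x)$. Normalized Jacobi sum: $\binom{A}{B}:=\frac{B(-1)}{q}J(A,\overline{B})$. Greene's hypergeometric function: for $n\ge 2$, characters $A_0,\dots,A_n,B_1,\dots,B_n$ and $x\in\mathbb{F}_q$, ${}_{n+1}F_n\!\left(\begin{matrix}A_0,\dots,A_n\\ B_1,\dots,B_n\end{matrix}\Big|\ x\right)_q:=\frac{q}{q-1}\sum_{\chi\in\widehat{\mathbb{F}}_q^\times}\binom{A_0\chi}{\chi}\binom{A_1\chi}{B_1\chi}\cdots\binom{A_n\chi}{B_n\chi}\chi(x)$, and for $n=1$, ${}_{2}F_1\!\left(\begin{matrix}A_0,A_1\\ B_1\end{matrix}\Big|\ x\right)_q:=\epsilon(x)\frac{A_1B_1(-1)}{q}\sum_{y\in\mathbb{F}_q}A_1(y)\overline{A_1}B_1(1-y)\overline{A_0}(1-xy)$. *)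

(* Defs.v *)
From HB Require Import structures.
From mathcomp Require Import all_boot all_order all_algebra all_field.
From mathcomp Require Import boolp classical_sets fsbigop.
Set Implicit Arguments. Unset Strict Implicit. Unset Printing Implicit Defensive.
Import Order.TTheory GRing.Theory Num.Theory.
Local Open Scope ring_scope.

Section Greene.
Variable F : finFieldType.

(* a "character" is represented by its extension to F (value 0 at 0) *)
Definition ch := F -> algC.

Definition is_mchar (chi : ch) : Prop :=
  [/\ chi 0 = 0, chi 1 = 1 & forall x y : F, chi (x * y) = chi x * chi y].

Definition mchars : set ch := [set chi | is_mchar chi].

Definition eps : ch := fun x => if x == 0 then 0 else 1.

Definition chmul (A B : ch) : ch := fun x => A x * B x.
Definition chbar (A : ch) : ch := fun x => (A x)^*.
Definition chpow (A : ch) (k : nat) : ch :=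
  fun x => if x == 0 then 0 else A x ^+ k.

Definition qF : algC := (#|F|)%:R.

Definition J2 (A B : ch) : algC := \sum_(x : F) A x * B (1 - x).
Definition J3 (A B C : ch) : algC :=
  \sum_(x : F) \sum_(y : F) \sum_(z : F | x + y + z == 1) A x * B y * C z.

Definition binom (A B : ch) : algC := B (-1) / qF * J2 A (chbar B).

(* Greene's {n+1}F_n for n >= 2: parameters A0, [A1..An], [B1..Bn] *)
Definition GreeneF (A0 : ch) (As Bs : seq ch) (x : F) : algC :=
  qF / (qF - 1) *
  \sum_(chi \in mchars)
     (binom (chmul A0 chi) chi *
      \prod_(ab <- zip As Bs) binom (chmul ab.1 chi) (chmul ab.2 chi) *
      chi x).

Definition Greene21 (A0 A1 B1 : ch) (x : F) : algC :=
  eps x * (A1 (-1) * B1 (-1)) / qF *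
  \sum_(y : F) A1 y * chmul (chbar A1) B1 (1 - y) * chbar A0 (1 - x * y).

(* F_q-rational points of the projective hypersurface
   x1^6+...+x6^6 = 6 lam x1...x6 in P^5, counted via the standard
   representatives (first nonzero coordinate equal to 1). *)
Definition proj_rep (v : {ffun 'I_6 -> F}) : bool :=
  [exists i : 'I_6, (v i == 1) && [forall j : 'I_6, (j < i)%N ==> (v j == 0)]].

Definition X6_points (lam : F) : nat :=
  #|[set v : {ffun 'I_6 -> F} | proj_rep v &&
      (\sum_(i < 6) v i ^+ 6 == 6%:R * lam * \prod_(i < 6) v i)]|.

End Greene.

(* Main.v *)
Require Import Defs.
From HB Require Import structures.
From mathcomp Require Import all_boot all_order all_fingroup all_algebra cyclic all_field.
From mathcomp Require Import all_character.
From mathcomp Require Import boolp classical_sets fsbigop.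
From mathcomp Require Import ring zify.

(** The affine points of the hypersurface are counted with an additive character psi:
    the number of solutions becomes a sum over the multiplicative characters chi of
    products of six Gauss sums g(chi omega_6^(w_1)) ... g(chi omega_6^(w_6)), one for
    each word w in (Z/6)^6 with zero sum, times g(conj(chi)^6). The Hasse-Davenport product
    formula for 6 turns g(chi^6) into the product of the g(chi omega_6^j), so that only
    the multiplicities of the letters of w matter, and, after summation over chi, only
    up to cyclic rotation. The points with a zero coordinate exactly account for the
    values of chi at which one of the Gauss sums degenerates. There are fourteen
    rotation classes, and each of them is one term of the formula, since a normalized
    Jacobi sum binom(A chi, B chi) is essentially g(A chi) / g(B chi).

    The product formula for 6 follows from those for 2 and 3. The one for 2 comes from
    counting the roots of x (s - x) = c. For the one for 3, put
    T(c) = 1 + sum_x eta(x^2 (x - 3)^2 - 4 x c) and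
    S(c) = sum_m omega_3(m) eta(m^2 + (4 c - 2) m + 1), with eta quadratic. Their Mellin
    transforms are, up to the same constants, the two sides of the formula, and they
    have the same L^2 norm, because Gauss sums have known absolute values. On the other
    hand 2 S(c) = T(c) + T(1 - c); the parallelogram law then forces
    T(c) = T(1 - c) = S(c). *)

Set Implicit Arguments. Unset Strict Implicit. Unset Printing Implicit Defensive.
Import Order.TTheory GRing.Theory Num.Theory.
Local Open Scope ring_scope.

(** * Characters of a finite field *)

Lemma finField_prim_root (F : finFieldType) :
  exists g : F, (#|F|.-1).-primitive_root g.
Proof.
have q1 : (1 < #|F|)%N by apply: finNzRing_gt1.
pose rs := enum (predC1 (0 : F)).
have szrs : size rs = #|F|.-1 by rewrite -cardE cardC1.
have /hasP[g _ g_prim] : has (#|F|.-1).-primitive_root rs.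
  apply: has_prim_root; rewrite ?szrs ?enum_uniq //; first by rewrite -ltnS prednK // ltnW.
  apply/allP => x; rewrite mem_enum inE => xn0; apply/unity_rootP.
  by apply: (mulfI xn0); rewrite -exprS prednK ?expf_card ?mulr1 // ltnW.
by exists g.
Qed.

(** A primitive root [g] of the field is sent, through the discrete logarithm, to a complex root of
    unity [z] of the same order. This character serves to show that the generator [omega] is
    injective. *)
Lemma exists_faithful_mchar (F : finFieldType) :
  exists2 chi : ch F, is_mchar chi & forall x, chi x = 1 -> x = 1.
Proof.
have [g gP] := finField_prim_root F.
have n_gt0 := prim_order_gt0 gP.
have [z zP] := C_prim_root_exists n_gt0.
pose pows := [seq g ^+ i | i <- iota 0 #|F|.-1].
pose log x := index x pows.
have powlog x : x != 0 -> g ^+ log x = x.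
  move=> xn0; have xn1 : x ^+ #|F|.-1 = 1.
    by apply: (mulfI xn0); rewrite -exprS prednK ?expf_card ?mulr1 // ltnW ?finNzRing_gt1.
  have xin : x \in pows.
    have [i ->] := prim_rootP gP xn1.
    by apply/mapP; exists (val i); rewrite // mem_iota add0n ltn_ord.
  have lt_log : (log x < #|F|.-1)%N by rewrite -index_mem size_map size_iota in xin.
  by have := nth_index 0 xin; rewrite (nth_map 0%N) ?size_iota // nth_iota // add0n.
have gn0 : g != 0 by rewrite (prim_root_eq0 gP) -lt0n.
exists (fun x => if x == 0 then 0 else z ^+ log x).
  split=> [||x y]; rewrite ?eqxx //.
    rewrite oner_eq0; apply/eqP.
    by rewrite -(expr0 z) (eq_prim_root_expr zP) -(eq_prim_root_expr gP) powlog ?expr0 ?oner_eq0.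
  rewrite mulf_eq0; case: eqP => [|/eqP] x0; first by rewrite mul0r.
  case: eqP => [|/eqP] y0; first by rewrite mulr0.
  apply/eqP; rewrite -exprD (eq_prim_root_expr zP) -(eq_prim_root_expr gP).
  by rewrite exprD !powlog ?mulf_neq0.
move=> x; case: eqP => [_ /eqP|/eqP x0]; first by rewrite eq_sym oner_eq0.
move/eqP; rewrite -(expr0 z) (eq_prim_root_expr zP) -(eq_prim_root_expr gP) powlog //.
by rewrite expr0 => /eqP.
Qed.

(** Any nontrivial irreducible character of the additive group works: it is linear because the group
    is abelian, and its sum vanishes by orthogonality to the trivial character. *)
Lemma exists_additive_char (F : finFieldType) :
  exists psi : F -> algC,
    [/\ forall x y, psi (x + y) = psi x * psi y,
        forall x, psi x != 0 & \sum_x psi x = 0].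
Proof.
pose G := [set: F]%G.
have abG : abelian G by apply/centsP => x _ y _; apply: addrC.
have [i i0] : exists i : Iirr G, i != 0.
  have : (1 < Nirr G)%N.
    by move: abG; rewrite NirrE card_classes_abelian => /eqP->; rewrite cardsT finNzRing_gt1.
  by move=> n1; exists (inord 1); apply/eqP => /(congr1 val); rewrite /= inordK.
have lin : 'chi_i \is a linear_char by apply: char_abelianP.
have psiM x y : 'chi_i (x + y) = 'chi_i x * 'chi_i y.
  by rewrite -(lin_charM lin) ?inE.
exists 'chi_i; split=> // [x|].
  by apply: lin_char_neq0; rewrite ?inE.
have : '['chi_i, 'chi_0] = 0 by rewrite cfdot_irr (negPf i0).
rewrite cfdotE => /eqP; rewrite mulf_eq0 invr_eq0 (negPf (neq0CG _)) /= => /eqP.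
under eq_bigr do rewrite irr0 cfun1E inE conjC1 mulr1.
by rewrite (eq_bigl predT) // => x; rewrite inE.
Qed.

Section MultChar.
Variables (F : finFieldType) (omega : ch F) (t : nat).
Hypothesis cardF : #|F| = (6 * t).+1.
Hypothesis omegaP : is_mchar omega.
Hypothesis omega_gen : forall chi : ch F, is_mchar chi -> exists k, chi = chpow omega k.

Local Notation n := (6 * t)%N.
Local Notation nC := ((6 * t)%:R : algC).
Local Notation q := (qF F).

Lemma t_gt0 : (0 < t)%N.
Proof. by have := finNzRing_gt1 F; rewrite cardF; case: (t). Qed.

Lemma n_gt1 : (1 < n)%N.
Proof. by have := t_gt0; lia. Qed.

Lemma qE : q = nC + 1.
Proof. by rewrite /qF cardF -natr1. Qed.

Lemma q_neq0 : q != 0.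
Proof. by rewrite /qF cardF pnatr_eq0. Qed.

Lemma n_neq0 : nC != 0.
Proof. by rewrite pnatr_eq0 -lt0n ltnW ?n_gt1. Qed.

Lemma expF_n (x : F) : x != 0 -> x ^+ n = 1.
Proof.
by move=> x0; apply: (mulfI x0); rewrite -exprS -cardF expf_card mulr1.
Qed.

Lemma omega_neq0 x : x != 0 -> omega x != 0.
Proof.
case: omegaP => _ o1 oM x0; apply/eqP => ox.
by move/eqP: o1; rewrite -(divff x0) oM ox mul0r eq_sym oner_eq0.
Qed.

Lemma omegaX x m : omega (x ^+ m) = omega x ^+ m.
Proof.
case: omegaP => _ o1 oM.
by elim: m => [|m IH]; rewrite ?expr0 ?o1 // !exprS oM IH.
Qed.

Lemma omega_n x : x != 0 -> omega x ^+ n = 1.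
Proof. by case: omegaP => _ o1 _ x0; rewrite -omegaX expF_n. Qed.

(* Characters are represented by their exponents, so that products of characters
   are sums in 'Z_n and 1/chi is - k. *)
Definition w (k : 'Z_n) : ch F := chpow omega k.

Lemma w0x k : w k 0 = 0.
Proof. by rewrite /w /chpow eqxx. Qed.

Lemma wE k x : x != 0 -> w k x = omega x ^+ k.
Proof. by rewrite /w /chpow => /negPf->. Qed.

Lemma w_neq0 k x : x != 0 -> w k x != 0.
Proof. by move=> x0; rewrite wE // expf_neq0 // omega_neq0. Qed.

Lemma w1x k : w k 1 = 1.
Proof. by case: omegaP => _ o1 _; rewrite wE ?oner_eq0 // o1 expr1n. Qed.

Lemma wM k x y : w k (x * y) = w k x * w k y.
Proof.
have [->|x0] := eqVneq x 0; first by rewrite mul0r w0x mul0r.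
have [->|y0] := eqVneq y 0; first by rewrite mulr0 w0x mulr0.
by case: omegaP => _ _ oM; rewrite !wE ?mulf_neq0 // oM exprMn.
Qed.

Lemma w_is_mchar k : is_mchar (w k).
Proof. by split; [exact: w0x | exact: w1x | exact: wM]. Qed.

Lemma wX k x m : w k (x ^+ m) = w k x ^+ m.
Proof. by elim: m => [|m IH]; rewrite ?expr0 ?w1x // !exprS wM IH. Qed.

Lemma wV k x : w k x^-1 = (w k x)^-1.
Proof.
have [->|x0] := eqVneq x 0; first by rewrite !(invr0, w0x).
by apply: (mulfI (w_neq0 k x0)); rewrite -wM !divff ?w1x // w_neq0.
Qed.

Lemma chpow_natr m : chpow omega m = w m%:R.
Proof.
apply/funext => x; rewrite /w /chpow; case: eqP => // /eqP x0.
by rewrite val_Zp_nat ?n_gt1 // expr_mod // omega_n.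
Qed.

Lemma w_00 x : w 0 x = (x != 0)%:R.
Proof. by rewrite /w /chpow; case: eqP. Qed.

Lemma wD a b x : w (a + b) x = w a x * w b x.
Proof.
have [->|x0] := eqVneq x 0; first by rewrite !w0x mul0r.
have -> : a + b = (a + b)%N%:R by rewrite natrD !natr_Zp.
by rewrite -chpow_natr {1}/chpow (negPf x0) exprD !wE.
Qed.

Lemma wMn a m x : x != 0 -> w (a *+ m) x = w a x ^+ m.
Proof.
move=> x0; elim: m => [|m IH]; first by rewrite mulr0n w_00 x0.
by rewrite mulrSr exprSr wD IH.
Qed.

Lemma wN a x : w (- a) x = (w a x)^-1.
Proof.
have [->|x0] := eqVneq x 0; first by rewrite !w0x invr0.
by apply: (mulfI (w_neq0 a x0)); rewrite -wD subrr w_00 x0 divff ?w_neq0.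
Qed.

Lemma wNV a x : w (- a) x = w a x^-1.
Proof. by rewrite wN wV. Qed.

Lemma w_norm a x : x != 0 -> `|w a x| = 1.
Proof.
move=> x0; have n0 : (0 < n)%N by rewrite ltnW ?n_gt1.
have : `|w a x| ^+ n = 1.
  by rewrite -normrX -wMn // -mulr_natr pchar_Zp ?n_gt1 // mulr0 w_00 x0 normr1.
by move/eqP; rewrite -(prednK n0) pexpr_eq1 // => /eqP.
Qed.

Lemma w_conj a x : (w a x)^* = w (- a) x.
Proof.
have [->|x0] := eqVneq x 0; first by rewrite !w0x conjC0.
by rewrite wN invC_norm w_norm // expr1n invr1 mul1r.
Qed.

(** A faithful character exists and is a power of [omega], so it is trivial wherever [omega] is. *)
Lemma omega_eq1 x : omega x = 1 -> x = 1.
Proof.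
have [chi chiP chi1] := exists_faithful_mchar F.
have [k chiE] := omega_gen chiP => ox; apply: chi1.
rewrite chiE /chpow ox expr1n; case: eqP => // x0.
by move: ox; rewrite x0; case: omegaP => -> _ _ /eqP; rewrite eq_sym oner_eq0.
Qed.

Lemma w_nontrivial k : k != 0 -> exists2 x, x != 0 & w k x != 1.
Proof.
move=> k0; have [x xP] := finField_prim_root F.
rewrite cardF /= in xP; have x0 : x != 0 by rewrite (prim_root_eq0 xP) -lt0n ltnW ?n_gt1.
exists x => //; apply: contra k0; rewrite wE // -omegaX => /eqP/omega_eq1/eqP.
rewrite -(prim_order_dvd xP) => kn.
have lt_k : (k < n)%N by rewrite -[X in (_ < X)%N](Zp_cast n_gt1) ltn_ord.
apply/eqP/val_inj => /=; apply/eqP; rewrite -leqn0 leqNgt; apply/negP => k_gt0.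
by have := dvdn_leq k_gt0 kn; rewrite leqNgt lt_k.
Qed.

Lemma w_inj : injective w.
Proof.
move=> a b ab; apply/eqP; rewrite -subr_eq0; apply/negP => /negP/w_nontrivial[x x0].
by rewrite wD wN ab divff ?eqxx ?w_neq0.
Qed.

Lemma sum_w_x k : \sum_x w k x = nC * (k == 0)%:R.
Proof.
have [->|k0] := eqVneq k 0.
  rewrite mulr1 (bigD1 0) //= w0x add0r (eq_bigr (fun=> 1)) => [|x x0]; last by rewrite w_00 x0.
  by rewrite sumr_const cardC1 cardF.
have [y y0 wy1] := w_nontrivial k0; rewrite mulr0.
rewrite -subr_eq0 in wy1; apply: (mulfI wy1);
  rewrite mulr0 mulrBl mul1r mulr_sumr [X in _ - X](reindex_inj (mulfI y0)) /= -sumrB.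
by apply: big1 => x _; rewrite wM subrr.
Qed.

Lemma sum_w_k x : \sum_k w k x = nC * (x == 1)%:R.
Proof.
have [->|x1] := eqVneq x 1.
  rewrite (eq_bigr (fun=> 1)) => [|k _]; last by rewrite w1x.
  by rewrite sumr_const card_ord Zp_cast ?n_gt1 // mulr1.
have [->|x0] := eqVneq x 0; first by rewrite mulr0 big1 // => k _; rewrite w0x.
have ox : omega x - 1 != 0 by rewrite subr_eq0; apply: contra x1 => /eqP/omega_eq1->.
rewrite mulr0; apply: (mulfI ox); rewrite mulr0 mulrBl mul1r mulr_sumr.
rewrite [X in _ - X](reindex_inj (addrI 1%:R)) /= -sumrB; apply: big1 => k _.
by rewrite wD -chpow_natr /chpow (negPf x0) expr1 subrr.
Qed.

Lemma w_m1_sqr a : w a (-1) * w a (-1) = 1.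
Proof. by rewrite -wM mulrNN mulr1 w1x. Qed.

Lemma wN_m1 a : w (- a) (-1) = w a (-1).
Proof. by rewrite wNV invrN1. Qed.

Lemma sum_mchars (f : ch F -> algC) :
  \sum_(chi \in @mchars F) f chi = \sum_k f (w k).
Proof.
rewrite (@eq_fsbigl _ _ _ _ _ _ [set` [seq w k | k <- enum 'Z_n]]).
  by rewrite -fsbig_seq ?big_map ?big_enum // map_inj_uniq ?enum_uniq //; apply: w_inj.
apply/seteqP; split=> [chi /omega_gen[k ->]|chi /= /mapP[k _ ->]]; last exact: w_is_mchar.
by rewrite chpow_natr /=; apply/mapP; exists k%:R; rewrite ?mem_enum.
Qed.

(** * Gauss and Jacobi sums *)

Variable psi : F -> algC.
Hypothesis psiD : forall x y, psi (x + y) = psi x * psi y.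
Hypothesis psi_neq0 : forall x, psi x != 0.
Hypothesis sum_psi : \sum_x psi x = 0.

Lemma psi0 : psi 0 = 1.
Proof. by apply: (mulfI (psi_neq0 0)); rewrite -psiD addr0 mulr1. Qed.

Lemma sum_psiM (u : F) : \sum_x psi (x * u) = q * (u == 0)%:R.
Proof.
have [->|u0] := eqVneq u 0.
  rewrite mulr1 (eq_bigr (fun=> 1)) => [|x _]; last by rewrite mulr0 psi0.
  by rewrite sumr_const.
by rewrite mulr0 -[RHS]sum_psi [RHS](reindex_inj (mulIf u0)).
Qed.

Definition gauss (k : 'Z_n) : algC := \sum_x w k x * psi x.
Local Notation g := gauss.

Lemma gaussM k z : z != 0 -> \sum_x w k x * psi (z * x) = w (- k) z * g k.
Proof.
move=> z0; rewrite /gauss [in RHS](reindex_inj (mulfI z0)) /= mulr_sumr.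
by apply: eq_bigr => x _; rewrite wM wN mulrA mulKf // w_neq0.
Qed.

Lemma sum_w0_psi u : \sum_x w 0 x * psi (u * x) = q * (u == 0)%:R - 1.
Proof.
have := sum_psiM u; rewrite (bigD1 0) //= mul0r psi0 => <-.
rewrite addrAC subrr add0r (bigD1 0) //= w0x mul0r add0r.
by apply: eq_bigr => x x0; rewrite w_00 x0 mul1r mulrC.
Qed.

Lemma gauss0 : g 0 = -1.
Proof.
by have := sum_w0_psi 1; rewrite oner_eq0 mulr0 add0r => <-; apply: eq_bigr => x _; rewrite mul1r.
Qed.

Lemma gaussN k : g k * g (- k) = w k (-1) * (q - nC * (k == 0)%:R).
Proof.
(* Replacing x by x y in the first Gauss sum cancels the characters of [y]; the inner sum over [y]
   is then q - 1 at x = -1 and -1 elsewhere. *)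
transitivity (\sum_x w k x * (\sum_y w 0 y * psi ((x + 1) * y))).
  rewrite mulr_sumr; under [RHS]eq_bigr do rewrite mulr_sumr.
  rewrite exchange_big /=; apply: eq_bigr => y _.
  have [->|y0] := eqVneq y 0.
    by rewrite w0x mul0r mulr0 big1 // => x _; rewrite w0x mul0r mulr0.
  rewrite mulrCA mulrA [X in X * _]mulrC [_ * w _ _]mulrC -gaussM // mulr_suml.
  apply: eq_bigr => x _; rewrite w_00 y0 mul1r -mulrA -psiD.
  by congr (_ * psi _); ring.
under eq_bigr do rewrite sum_w0_psi mulrBr mulr1.
rewrite sumrB sum_w_x (bigD1 (-1)) //= addNr eqxx mulr1 big1 ?addr0 => [|x xN1].
  have [->|k0] := eqVneq k 0; last by rewrite !mulr0 !subr0.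
  by rewrite w_00 oppr_eq0 oner_eq0 !mul1r.
by rewrite addr_eq0 (negPf xN1) !mulr0.
Qed.

Lemma gauss_neq0 k : g k != 0.
Proof.
apply/eqP => gk; have /esym/eqP := gaussN k; rewrite gk mul0r mulf_eq0 => /orP[|].
  by rewrite (negPf (w_neq0 k _)) // oppr_eq0 oner_eq0.
rewrite qE; have [_|k0] := eqVneq k 0; first by rewrite mulr1 addrAC subrr add0r oner_eq0.
by rewrite mulr0 subr0 -qE (negPf q_neq0).
Qed.

(* Chosen so that [g (- k) = w k (-1) * q * corr k / g k] also holds for k = 0. *)
Definition corr (k : 'Z_n) : algC := 1 - nC / q * (k == 0)%:R.

Lemma gauss_opp k : g (- k) = w k (-1) * q * corr k / g k.
Proof.
apply: (mulfI (gauss_neq0 k)); rewrite gaussN /corr; field.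
by rewrite gauss_neq0 q_neq0.
Qed.

Lemma corr0 : corr 0 = q^-1.
Proof. by rewrite /corr eqxx mulr1 -{1}(divff q_neq0) -mulrBl [X in X - _]qE addrAC subrr add0r
  mul1r. Qed.

Lemma corr1 k : k != 0 -> corr k = 1.
Proof. by move=> /negPf k0; rewrite /corr k0 mulr0 subr0. Qed.

Lemma sum_w_psi k z :
  \sum_x w k x * psi (z * x) = w (- k) z * g k + (z == 0)%:R * nC * (k == 0)%:R.
Proof.
have [->|z0] := eqVneq z 0; last by rewrite gaussM // !mul0r addr0.
rewrite w0x mul0r add0r mul1r -sum_w_x.
by apply: eq_bigr => x _; rewrite mul0r psi0 mulr1.
Qed.

(** The condition x + y = 1 is detected by summing psi(z (x + y - 1)) over z. The value z = 0 gives
    the degenerate term; for the other z both inner sums are Gauss sums, and the sum over z is a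
    third one. [J3_gauss] has one more variable. *)
Lemma J2_gauss a b :
  q * J2 (w a) (w b) =
  nC ^+ 2 * (a == 0)%:R * (b == 0)%:R + w (a + b) (-1) * g (- (a + b)) * g a * g b.
Proof.
transitivity (\sum_z psi (z * -1) * (\sum_x w a x * psi (z * x)) * (\sum_y w b y * psi (z * y))).
  under [RHS]eq_bigr => z _ do rewrite -mulrA mulrCA mulr_suml.
  rewrite exchange_big /= /J2 mulr_sumr; apply: eq_bigr => x _.
  under [RHS]eq_bigr => z _ do rewrite !mulr_sumr.
  rewrite exchange_big /= (bigD1 (1 - x)) //= [X in _ = _ + X]big1 ?addr0 => [|y ny].
    have := sum_psiM 0; rewrite eqxx mulr1 => <-; rewrite mulr_suml; apply: eq_bigr => z _.
    have -> : z * 0 = z * -1 + z * x + z * (1 - x) by ring.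
    by rewrite !psiD; ring.
  have := sum_psiM (y - (1 - x)); rewrite subr_eq0 (negPf ny) mulr0 => S.
  transitivity (w a x * w b y * 0); last by rewrite mulr0.
  rewrite -[X in _ = _ * X]S mulr_sumr.
  apply: eq_bigr => z _.
  have -> : z * (y - (1 - x)) = z * -1 + z * x + z * y by ring.
  by rewrite !psiD; ring.
under eq_bigr => z _ do rewrite !sum_w_psi.
rewrite (bigD1 0) //= eqxx !w0x !mul0r !add0r !mul1r psi0 mul1r.
congr (_ + _); first by ring.
have m1n0 : (-1 : F) != 0 by rewrite oppr_eq0 oner_eq0.
have := gaussM (- (a + b)) m1n0; rewrite opprK => <-.
rewrite !mulr_suml [RHS](bigD1 0) //= w0x !mul0r add0r; apply: eq_bigr => z z0.
by rewrite (negPf z0) !mul0r !addr0 opprD wD mulrN1 mulN1r; ring.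
Qed.

Lemma J3_gauss a b c :
  q * J3 (w a) (w b) (w c) =
  nC ^+ 3 * (a == 0)%:R * (b == 0)%:R * (c == 0)%:R
  + w (a + b + c) (-1) * g (- (a + b + c)) * g a * g b * g c.
Proof.
transitivity (\sum_z psi (z * -1) * (\sum_x w a x * psi (z * x)) *
    (\sum_y w b y * psi (z * y)) * (\sum_u w c u * psi (z * u))).
  have out1 (c0 x y u : algC) : c0 * x * y * u = x * (c0 * y * u) by ring.
  have out2 (c0 d y u : algC) : c0 * (d * y * u) = y * (c0 * d * u) by ring.
  under [RHS]eq_bigr => z _ do rewrite out1 mulr_suml.
  rewrite exchange_big /= /J3 mulr_sumr; apply: eq_bigr => x _.
  under [RHS]eq_bigr => z _ do rewrite out2 mulr_suml.
  rewrite exchange_big /= mulr_sumr; apply: eq_bigr => y _.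
  under [RHS]eq_bigr => z _ do rewrite mulrA mulr_sumr.
  rewrite exchange_big /= mulr_sumr big_mkcond /=; apply: eq_bigr => u _.
  have := sum_psiM (x + y + u - 1); rewrite subr_eq0 => S.
  transitivity (w a x * w b y * w c u * (q * (x + y + u == 1)%:R)).
    by case: eqP => _ /=; rewrite ?mulr0 ?mulr1 // mulrC.
  rewrite -S mulr_sumr; apply: eq_bigr => z _.
  have -> : z * (x + y + u - 1) = z * -1 + z * x + z * y + z * u by ring.
  by rewrite !psiD; ring.
under eq_bigr => z _ do rewrite !sum_w_psi.
rewrite (bigD1 0) //= eqxx !w0x !mul0r !add0r !mul1r psi0 mul1r.
congr (_ + _); first by ring.
have m1n0 : (-1 : F) != 0 by rewrite oppr_eq0 oner_eq0.
have := gaussM (- (a + b + c)) m1n0; rewrite opprK => <-.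
rewrite !mulr_suml [RHS](bigD1 0) //= w0x !mul0r add0r; apply: eq_bigr => z z0.
by rewrite (negPf z0) !mul0r !addr0 !opprD !wD mulrN1 mulN1r; ring.
Qed.

(** * Quadratic character sums and the product formula for 2 *)

Lemma natr_cardF : #|F|%:R = 0 :> F.
Proof.
have : \sum_(x : F) x = \sum_(x : F) x + #|F|%:R.
  by rewrite {1}(reindex_inj (addIr 1)) big_split sumr_const.
by rewrite -[X in X = _]addr0 => /addrI.
Qed.

(** The cardinality 6 t + 1 is zero in F, so 6 = 0 would give 1 = 0. *)
Lemma six_neq0 : 6%:R != 0 :> F.
Proof.
apply/eqP => six0; have := natr_cardF.
by rewrite cardF -natr1 natrM six0 mul0r add0r => /eqP; rewrite oner_eq0.
Qed.

Lemma two_neq0 : 2%:R != 0 :> F.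
Proof. by apply: contra six_neq0 => /eqP x0; rewrite (natrM _ 2 3) x0 mul0r. Qed.

Lemma three_neq0 : 3%:R != 0 :> F.
Proof. by apply: contra six_neq0 => /eqP x0; rewrite (natrM _ 2 3) x0 mulr0. Qed.

Lemma four_neq0 : 4%:R != 0 :> F.
Proof. by rewrite (natrM _ 2 2) mulf_neq0 ?two_neq0. Qed.

(* The exponent of omega_6 ^ j. *)
Definition e6 (j : nat) : 'Z_n := (j * t)%:R.

Lemma e6D i j : e6 (i + j) = e6 i + e6 j.
Proof. by rewrite /e6 mulnDl natrD. Qed.

Lemma e6_mod j : e6 (j %% 6) = e6 j.
Proof.
rewrite [in RHS](divn_eq j 6) e6D {2}/e6 -mulnA natrM pchar_Zp ?n_gt1 //.
by rewrite mulr0 add0r.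
Qed.

Lemma e6_0 : e6 0 = 0. Proof. by []. Qed.

Lemma e6_6 : e6 6 = 0. Proof. by rewrite -e6_mod. Qed.

Lemma e6N j : (j <= 6)%N -> - e6 j = e6 (6 - j).
Proof. by move=> j6; apply: (addrI (e6 j)); rewrite subrr -e6D subnKC ?e6_6. Qed.

Lemma e6Mn j m : e6 j *+ m = e6 (j * m).
Proof. by rewrite /e6 -mulrnA mulnAC. Qed.

Lemma e6_eq0 j : (e6 j == 0) = (j %% 6 == 0)%N.
Proof.
rewrite -e6_mod; case: (j %% 6)%N (ltn_pmod j (isT : 0 < 6)%N) => [|i] i6; first by rewrite eqxx.
apply/eqP => /(congr1 val) /=; rewrite val_Zp_nat ?n_gt1 // modn_small ?ltn_pmul2r ?t_gt0 //.
by move/eqP; rewrite muln_eq0 /= eqn0Ngt t_gt0.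
Qed.

Lemma w_e6_m1_even j : w (e6 (2 * j)) (-1) = 1.
Proof. by rewrite mulSn mul1n e6D wD w_m1_sqr. Qed.

Definition eta : ch F := w (e6 3).

Lemma etaN : - e6 3 = e6 3. Proof. by rewrite e6N. Qed.

Lemma eta_sqr x : x != 0 -> eta (x ^+ 2) = 1.
Proof. by move=> x0; rewrite /eta wX -wMn // e6Mn (_ : e6 _ = 0) ?e6_6 // w_00 x0. Qed.

Lemma etaM x y : eta (x * y) = eta x * eta y. Proof. exact: wM. Qed.

Lemma eta0 : eta 0 = 0. Proof. exact: w0x. Qed.

Lemma eta1 : eta 1 = 1. Proof. exact: w1x. Qed.

Lemma eta_real x : eta x \is Num.real.
Proof. by rewrite CrealE w_conj etaN. Qed.

Lemma eta_mul_self x : x != 0 -> eta x * eta x = 1.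
Proof. by move=> x0; rewrite -etaM -expr2 eta_sqr. Qed.

Lemma torsion_sum m d (f : 'Z_n -> algC) : (m * d = n)%N ->
  \sum_k f k * (k *+ m == 0)%:R = \sum_(j < m) f (j * d)%:R.
Proof.
have n_gt0 := ltnW n_gt1; case: m => [|m] md; first by move: n_gt0; rewrite -{1}md.
have d_gt0 : (0 < d)%N by move: n_gt0; rewrite -{1}md; case: (d); rewrite ?muln0.
have lt_n (j : 'I_m.+1) : (j * d < n)%N by rewrite -md ltn_pmul2r.
rewrite (eq_bigr (fun k : 'Z_n => if k *+ m.+1 == 0 then f k else 0)) => [|k _]; last first.
  by case: eqP; rewrite ?mulr1 ?mulr0.
rewrite -big_mkcond /= (reindex_onto (fun j : 'I_m.+1 => (j * d)%:R) (fun k : 'Z_n =>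
  inord (k %/ d))) /=.
  apply: eq_bigl => j; have -> : (j * d)%:R *+ m.+1 = 0 :> 'Z_n.
    transitivity (j%:R * n%:R : 'Z_n); last by rewrite pchar_Zp ?n_gt1 ?mulr0.
    by rewrite -natrM -mulrnA -mulnA [(d * _)%N]mulnC md.
  by rewrite eqxx /= val_Zp_nat ?n_gt1 // modn_small // mulnK // inord_val eqxx.
move=> k; rewrite -{1}[k]natr_Zp -mulrnA => /eqP/(congr1 val);
  rewrite /= val_Zp_nat ?n_gt1 // => kmn.
have dk : (d %| k)%N by rewrite -(dvdn_pmul2r (isT : 0 < m.+1)%N) [(d * _)%N]mulnC md; apply/eqP.
have lt_kn : (k < n)%N by rewrite -[X in (_ < X)%N](Zp_cast n_gt1) ltn_ord.
by rewrite inordK ?ltn_divLR ?md // divnK // natr_Zp.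
Qed.

(** Orthogonality in [k] detects x^m = y; summing over x then retains only the [k] killed by m,
    which are the m multiples of d. *)
Lemma card_pow_fiber m d y : (m * d = n)%N -> y != 0 ->
  \sum_x (x ^+ m == y)%:R = \sum_(j < m) w (j * d)%:R y.
Proof.
move=> md y0; rewrite -(torsion_sum (fun k => w k y) md).
have m0 : (0 < m)%N by have := ltnW n_gt1; rewrite -{1}md; case: (m).
apply: (mulfI n_neq0); rewrite !mulr_sumr.
transitivity (\sum_x \sum_k w k (y * (x ^+ m)^-1)).
  apply: eq_bigr => x _; rewrite sum_w_k; congr (_ * _%:R).
  have [->|x0] := eqVneq x 0.
    by rewrite expr0n gtn_eqF //= invr0 mulr0 ![0 == _]eq_sym (negPf y0) oner_eq0.
  by rewrite -[_ == 1](inj_eq (mulIf (expf_neq0 m x0))) divfK ?expf_neq0 // mul1r eq_sym.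
rewrite exchange_big; apply: eq_bigr => k _ /=.
have -> : (k *+ m == 0) = (- k *+ m == 0) by rewrite mulNrn oppr_eq0.
rewrite mulrCA -sum_w_x mulr_sumr; apply: eq_bigr => x _.
have [->|x0] := eqVneq x 0; first by rewrite expr0n gtn_eqF // invr0 mulr0 !w0x mulr0.
by rewrite wM wV wX -wMn // mulNrn wN.
Qed.

(** The sum is grouped by the value of x^m. At y = 0 the fibre has one point whereas all characters
    vanish, which is why [f 0] has to be zero. *)
Lemma sum_comp_pow m d (f : F -> algC) : (m * d = n)%N -> f 0 = 0 ->
  \sum_x f (x ^+ m) = \sum_y f y * \sum_(j < m) w (j * d)%:R y.
Proof.
move=> md f0; transitivity (\sum_y \sum_x f y * (x ^+ m == y)%:R).
  rewrite exchange_big; apply: eq_bigr => x _.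
  rewrite (bigD1 (x ^+ m)) //= eqxx mulr1 big1 ?addr0 // => y.
  by rewrite eq_sym => /negPf->; rewrite mulr0.
apply: eq_bigr => y _; rewrite -mulr_sumr.
have [->|y0] := eqVneq y 0; first by rewrite f0 !mul0r.
by rewrite (card_pow_fiber md).
Qed.

Lemma card_sqrt y : \sum_x (x ^+ 2 == y)%:R = 1 + eta y.
Proof.
have [->|y0] := eqVneq y 0.
  rewrite eta0 addr0 (bigD1 0) //= expr0n eqxx big1 ?addr0 // => x x0.
  by rewrite expf_eq0 (negPf x0) andbF.
rewrite (@card_pow_fiber 2 (3 * t)) ?mulnA // 2!big_ord_recl big_ord0 addr0 /=.
by rewrite mul0n w_00 y0 mul1n.
Qed.

Lemma card_quadratic a b c : a != 0 ->
  \sum_x (a * x ^+ 2 + b * x + c == 0)%:R = 1 + eta (b ^+ 2 - 4%:R * a * c).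
Proof.
move=> a0; rewrite -card_sqrt.
have a2 : 2%:R * a != 0 by rewrite mulf_neq0 ?two_neq0.
rewrite [RHS](reindex_inj (addIr b)) [RHS](reindex_inj (mulfI a2)) /=.
apply: eq_bigr => x _; congr (_%:R); rewrite -[_ == _ - _]subr_eq0.
rewrite (_ : _ - (_ - _) = 4%:R * a * (a * x ^+ 2 + b * x + c)); last by ring.
by rewrite mulf_eq0 (negPf (mulf_neq0 four_neq0 a0)).
Qed.

Lemma eta4 : eta 4%:R = 1.
Proof. by rewrite (_ : 4%:R = 2%:R ^+ 2) ?eta_sqr ?two_neq0 // -natrX. Qed.

Lemma sum_eta : \sum_x eta x = 0.
Proof. by rewrite sum_w_x e6_eq0 mulr0. Qed.

Lemma J2_eta_eta : J2 eta eta = - eta (-1).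
Proof.
apply: (mulfI q_neq0); rewrite J2_gauss e6_eq0 !mulr0 add0r -e6D e6_6 oppr0 gauss0.
by rewrite -mulrA -{2}etaN gaussN e6_eq0 w_00 oppr_eq0 oner_eq0 /eta mulr0 subr0 /=; ring.
Qed.

(** Completing the square leaves x^2 - d, with d a quarter of the discriminant. In the variable y =
    x^2, with 1 + eta(y) preimages, the sum becomes a multiple of J(eta, eta). *)
Lemma sum_eta_quadratic a b : a ^+ 2 - 4%:R * b != 0 ->
  \sum_x eta (x ^+ 2 + a * x + b) = -1.
Proof.
move=> disc; have [d dE] : {d | d = (a ^+ 2 - 4%:R * b) / 4%:R} by eexists.
have d0 : d != 0 by rewrite dE mulf_neq0 ?invr_eq0 ?four_neq0.
have sq0 : \sum_x eta (x ^+ 2 - d) = -1.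
  transitivity (\sum_y eta (y - d) * \sum_x (x ^+ 2 == y)%:R).
    under [RHS]eq_bigr do rewrite mulr_sumr.
    rewrite exchange_big; apply: eq_bigr => x _ /=.
    rewrite (bigD1 (x ^+ 2)) //= eqxx mulr1 big1 ?addr0 // => y.
    by rewrite eq_sym => /negPf->; rewrite mulr0.
  under eq_bigr do rewrite card_sqrt mulrDr mulr1.
  rewrite big_split /= -(reindex_inj (addIr (- d)) (P := xpredT) (F := fun y =>
    eta y)) /= sum_eta add0r.
  rewrite (reindex_inj (mulfI d0)) /=.
  transitivity (eta (-1) * J2 eta eta); last first.
    by rewrite J2_eta_eta mulrN eta_mul_self // oppr_eq0 oner_eq0.
  rewrite mulr_sumr; apply: eq_bigr => y _.
  rewrite (_ : d * y - d = d * (-1 * (1 - y))); last by ring.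
  rewrite !etaM -[RHS]mul1r -[X in _ = X * _](eta_mul_self d0); ring.
rewrite -sq0 (reindex_inj (addIr (- (a / 2%:R)))) /=; apply: eq_bigr => x _.
by congr eta; rewrite dE; field; rewrite ?four_neq0 ?two_neq0.
Qed.

(** For A nonzero the substitution c = (A / B) c' produces the Jacobi sum. For A = 0 only a
    character sum is left, which is nonzero just for [k = e6 3]. *)
Lemma sum_w_eta_linear k A B : B != 0 ->
  \sum_c w k c * eta (A - B * c) =
  eta A * w k A * w (- k) B * J2 (w k) eta + (A == 0)%:R * eta (- B) * (nC * (k == e6 3)%:R).
Proof.
move=> B0; have [->|A0] := eqVneq A 0.
  rewrite eta0 !mul0r add0r mul1r -[k == _]subr_eq0 -etaN opprK -sum_w_x mulr_sumr.
  by apply: eq_bigr => c _; rewrite sub0r -mulNr etaM wD /eta; ring.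
have AB0 : A / B != 0 by rewrite mulf_neq0 ?invr_eq0.
rewrite !mul0r addr0 (reindex_inj (mulfI AB0)) /= /J2 mulr_sumr.
apply: eq_bigr => c _; rewrite (_ : A - _ = A * (1 - c)); last by field.
by rewrite etaM !wM wV wN; ring.
Qed.

(* Writing a product xy = c with x + y = s, the number of x is 1 + eta(s^2 - 4c). *)
Lemma gauss_sqr k :
  g k ^+ 2 = w (- k) 4%:R * g (k *+ 2) * J2 (w k) eta + nC * eta (-1) * (k == e6 3)%:R.
Proof.
have convol s : \sum_x w k (x * (s - x)) =
    nC * (k == 0)%:R + w (k *+ 2) s * w (- k) 4%:R * J2 (w k) eta
    + (s == 0)%:R * eta (-1) * (nC * (k == e6 3)%:R).
  transitivity (\sum_c w k c * (1 + eta (s ^+ 2 - 4%:R * c))).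
    transitivity (\sum_c \sum_x w k c * (x * (s - x) == c)%:R).
      rewrite exchange_big; apply: eq_bigr => x _ /=.
      rewrite (bigD1 (x * (s - x))) //= eqxx mulr1 big1 ?addr0 // => y.
      by rewrite eq_sym => /negPf->; rewrite mulr0.
    apply: eq_bigr => c _; rewrite -mulr_sumr; congr (_ * _).
    have := @card_quadratic (-1) s (- c); rewrite oppr_eq0 oner_eq0 => /(_ isT).
    rewrite (_ : _ - _ = s ^+ 2 - 4%:R * c); last by ring.
    move=> <-; apply: eq_bigr => x _; congr (_%:R); rewrite -subr_eq0; congr (_ == 0); ring.
  under eq_bigr do rewrite mulrDr mulr1.
  rewrite big_split /= sum_w_x sum_w_eta_linear ?four_neq0 // -addrA; congr (_ + (_ + _)).
    have [->|s0] := eqVneq s 0; first by rewrite expr2 mulr0 eta0 !w0x !mul0r.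
    by rewrite eta_sqr // mul1r wX wMn.
  by rewrite expf_eq0 /= -[- 4%:R]mulN1r etaM eta4 mulr1.
transitivity (\sum_s psi s * \sum_x w k (x * (s - x))).
  rewrite expr2 {1}/gauss mulr_suml; under [RHS]eq_bigr do rewrite mulr_sumr.
  rewrite exchange_big; apply: eq_bigr => x _ /=.
  rewrite /gauss mulr_sumr [RHS](reindex_inj (addrI x)) /=; apply: eq_bigr => y _.
  by rewrite psiD addrAC subrr add0r wM; ring.
under eq_bigr do rewrite convol mulrDr mulrDr.
(* The term with [k == 0] does not depend on [s] and disappears because [psi] sums to zero; the last
   term lives at s = 0 only. *)
rewrite big_split big_split /= -mulr_suml sum_psi mul0r add0r; congr (_ + _).
  by rewrite /gauss mulr_sumr mulr_suml; apply: eq_bigr => s _; ring.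
rewrite (bigD1 0) //= psi0 eqxx big1 ?addr0 => [|s /negPf s0]; first by rewrite !mul1r; ring.
by rewrite s0 !mul0r mulr0.
Qed.

(** For [k != e6 3] the Jacobi sum of [gauss_sqr] is g(k) g(h) / g(k + h), and a factor g(k)
    cancels. For [k = e6 3] both sides are g(0) g(h), since eta(4) = 1. *)
Lemma hasse_davenport2 k : g k * g (k + e6 3) = w (- k) 4%:R * g (k *+ 2) * g (e6 3).
Proof.
have [->|kh] := eqVneq k (e6 3).
  by rewrite -e6D e6_6 gauss0 e6Mn e6_6 gauss0 etaN mulrC -/eta eta4 mul1r.
have kh0 : k + e6 3 != 0 by rewrite -etaN subr_eq0.
have J : J2 (w k) eta = g k * g (e6 3) / g (k + e6 3).
  apply: (mulfI q_neq0); rewrite J2_gauss e6_eq0 mulr0 add0r gauss_opp corr1 //.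
  transitivity (w (k + e6 3) (-1) * w (k + e6 3) (-1) * (q * (g k * g (e6 3) / g (k + e6 3)))).
    by ring.
  by rewrite w_m1_sqr mul1r.
apply: (mulfI (gauss_neq0 k)); rewrite mulrA -expr2 gauss_sqr (negPf kh) mulr0 addr0 J.
by field; rewrite gauss_neq0.
Qed.

(** * The product formulas for 3 and 6 *)

Local Notation r := (e6 2).
Local Notation h := (e6 3).

Definition cubicE (c : F) : algC := \sum_x eta (x ^+ 2 * (x - 3%:R) ^+ 2 - 4%:R * x * c).
(** The argument of [eta] is m^2 + (4 c - 2) m + 1, written in the shape [A - B * c] of
    [sum_w_eta_linear]. *)
Definition cubicS (c : F) : algC :=
  \sum_m w r m * eta ((m - 1) ^+ 2 - (- (4%:R * m)) * c).
Definition mellin (f : F -> algC) (k : 'Z_n) : algC := \sum_c w k c * f c.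

(** Orthogonality in [k] forces c = d. The squares are not absolute squares, but they give the L^2
    norm for the real-valued functions to which this is applied; c = 0 drops out as every character
    vanishes there. *)
Lemma mellin_parseval f :
  \sum_k mellin f k * mellin f (- k) = nC * \sum_(c | c != 0) f c ^+ 2.
Proof.
transitivity (\sum_c \sum_d f c * f d * \sum_k w k (c / d)).
  rewrite /mellin; under eq_bigr do rewrite mulr_suml.
  rewrite exchange_big; apply: eq_bigr => c _ /=.
  under eq_bigr do rewrite mulr_sumr.
  rewrite exchange_big; apply: eq_bigr => d _ /=.
  by rewrite mulr_sumr; apply: eq_bigr => k _; rewrite wM wNV; ring.
rewrite mulr_sumr [RHS]big_mkcond /=; apply: eq_bigr => c _.
under eq_bigr do rewrite sum_w_k.
have [->|c0] := eqVneq c 0.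
  by rewrite big1 // => d _; rewrite mul0r eq_sym oner_eq0 !mulr0.
rewrite (bigD1 c) //= divff // eqxx big1 ?addr0 => [|d dc]; first by rewrite mulr1 expr2 mulrC.
have [->|d0] := eqVneq d 0; first by rewrite invr0 mulr0 eq_sym oner_eq0 !mulr0.
by rewrite -[_ == 1](inj_eq (mulIf d0)) divfK // mul1r eq_sym (negPf dc) !mulr0.
Qed.

Lemma eq_mellin f1 f2 : (forall c, c != 0 -> f1 c = f2 c) -> mellin f1 =1 mellin f2.
Proof.
move=> f12 k; apply: eq_bigr => c _.
by have [->|c0] := eqVneq c 0; [rewrite w0x !mul0r | rewrite f12].
Qed.

(** Since 3 divides q - 1 there is a primitive cube root of unity [z], and (2 z + 1)^2 = -3. *)
Lemma eta_m3 : eta (- 3%:R) = 1.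
Proof.
have [x xP] := finField_prim_root F; rewrite cardF /= in xP.
pose z := x ^+ (2 * t).
have z1 : z != 1.
  rewrite /z -(expr0 x) (eq_prim_root_expr xP) mod0n modn_small ?muln_eq0 /= ?eqn0Ngt ?t_gt0 //.
  by rewrite ltn_pmul2r ?t_gt0.
have z3 : z ^+ 3 = 1 by rewrite /z -exprM mulnAC -(expr0 x); apply/eqP;
  rewrite (eq_prim_root_expr xP) modnn mod0n.
have : (z - 1) * (z ^+ 2 + z + 1) = 0 by rewrite -[RHS](subrr 1) -{3}z3; ring.
move/eqP; rewrite mulf_eq0 subr_eq0 (negPf z1) /= => /eqP zz.
have sq : (2%:R * z + 1) ^+ 2 = - 3%:R.
  by rewrite -[RHS]addr0 -(mulr0 4%:R) -zz; ring.
by rewrite -sq eta_sqr // -sqrf_eq0 sq oppr_eq0 three_neq0.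
Qed.

Lemma wMnS k m x : w (k *+ m.+1) x = w k (x ^+ m.+1).
Proof.
have [->|x0] := eqVneq x 0; first by rewrite exprS mul0r !w0x.
by rewrite wMn // wX.
Qed.

(** Summing over c first makes the argument of [eta] linear in the variable, hence gives a Jacobi
    sum with [eta]; the sum over x is then a second Jacobi sum. [mellin_cubicS] goes the same
    way. *)
Lemma mellin_cubicE k :
  mellin cubicE k =
  w k 27%:R * w (- k) 4%:R * J2 (w k) (w (k *+ 2)) * J2 (w k) eta + nC * (k == h)%:R.
Proof.
have inner x : \sum_c w k c * eta (x ^+ 2 * (x - 3%:R) ^+ 2 - 4%:R * x * c) =
    w (- k) 4%:R * J2 (w k) eta * (w k x * w (k *+ 2) (x - 3%:R))
    + (x == 3%:R)%:R * (nC * (k == h)%:R).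
  have [->|x0] := eqVneq x 0.
    rewrite w0x eq_sym (negPf three_neq0) !mul0r mulr0 addr0; apply: big1 => c _.
    by rewrite expr2 !(mul0r, mulr0) subr0 eta0 mulr0.
  rewrite sum_w_eta_linear ?mulf_neq0 ?four_neq0 // -exprMn; congr (_ + _); last first.
    rewrite expf_eq0 /= mulf_eq0 (negPf x0) /= subr_eq0.
    have [->|_] := eqVneq x 3%:R; last by rewrite !mul0r.
    by rewrite -mulrN etaM eta4 eta_m3 !mul1r.
  have [->|x3] := eqVneq x 3%:R.
    by rewrite subrr mulr0 expr2 mulr0 eta0 (w0x (k *+ 2)) !(mul0r, mulr0).
  rewrite eta_sqr ?mulf_neq0 ?subr_eq0 // mul1r (wMnS k 1) !wX !wM !wN.
  by field; rewrite !w_neq0 ?four_neq0.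
rewrite /mellin /cubicE; under eq_bigr do rewrite mulr_sumr.
rewrite exchange_big /=; under eq_bigr do rewrite inner.
rewrite big_split /=; congr (_ + _); last first.
  by rewrite (bigD1 3%:R) //= eqxx mul1r big1 ?addr0 // => x /negPf->; rewrite mul0r.
rewrite -mulr_sumr (_ : \sum_x _ = w k 27%:R * J2 (w k) (w (k *+ 2))); first by ring.
rewrite (reindex_inj (mulfI three_neq0)) /= mulr_sumr; apply: eq_bigr => x _.
rewrite (_ : 3%:R * x - 3%:R = - 3%:R * (1 - x)); last by ring.
(* After x is replaced by 3 x, the factor 3 comes out of [w k] and the factor -3 out of
   [w (k *+ 2)], where it counts squared. *)
rewrite (_ : 27%:R = 3%:R * (- 3%:R) ^+ 2); last by ring.
by rewrite !(wMnS k 1) exprMn !wM; ring.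
Qed.

Lemma mellin_cubicS k :
  mellin cubicS k =
  w (- k) (- 4%:R) * J2 (w k) eta * J2 (w (r - k)) (w (k *+ 2)) + nC * (k == h)%:R.
Proof.
have inner m : w r m * \sum_c w k c * eta ((m - 1) ^+ 2 - (- (4%:R * m)) * c) =
    w (- k) (- 4%:R) * J2 (w k) eta * (w (r - k) m * w (k *+ 2) (1 - m))
    + (m == 1)%:R * (nC * (k == h)%:R).
  have [->|m0] := eqVneq m 0.
    by rewrite !w0x eq_sym oner_eq0 !mul0r mulr0 addr0.
  rewrite sum_w_eta_linear ?oppr_eq0 ?mulf_neq0 ?four_neq0 // mulrDr; congr (_ + _); last first.
    rewrite expf_eq0 /= subr_eq0.
    have [->|_] := eqVneq m 1; last by rewrite !mul0r mulr0.
    by rewrite mulr1 opprK eta4 w1x !mul1r.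
  have [->|m1] := eqVneq m 1.
    by rewrite subrr expr2 mulr0 eta0 (w0x (k *+ 2)) !(mul0r, mulr0).
  rewrite eta_sqr ?subr_eq0 // mul1r (wMnS k 1) -[1 - m]opprB sqrrN wD !wN -mulNr !wM.
  by field; rewrite !w_neq0 ?oppr_eq0 ?four_neq0.
rewrite /mellin /cubicS; under eq_bigr do rewrite mulr_sumr.
rewrite exchange_big /=; transitivity (\sum_m w r m * \sum_c w k c * eta ((m - 1) ^+ 2 - (- (4%:R
  * m)) * c)).
  by apply: eq_bigr => m _; rewrite mulr_sumr; apply: eq_bigr => c _; ring.
under eq_bigr do rewrite inner.
rewrite big_split /=; congr (_ + _); last first.
  by rewrite (bigD1 1) //= eqxx mul1r big1 ?addr0 // => x /negPf->; rewrite mul0r.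
by rewrite -mulr_sumr.
Qed.

Lemma gauss_eta_sqr : g h ^+ 2 = eta (-1) * q.
Proof. by rewrite expr2 -{2}etaN gaussN e6_eq0 mulr0 subr0. Qed.

Lemma w_r_m1 : w r (-1) = 1.
Proof. exact: (w_e6_m1_even 1). Qed.

Lemma q_mellin_cubicS k : q * mellin cubicS k = g k ^+ 2 * g (- (r + k)) * g (r - k).
Proof.
have r2k : (r - k == 0) && (k *+ 2 == 0) = false.
  apply/andP => -[/eqP/eqP]; rewrite subr_eq0 => /eqP <-.
  by rewrite e6Mn e6_eq0.
have J := J2_gauss (r - k) (k *+ 2); rewrite -mulrA -natrM mulnb r2k mulr0 add0r in J.
have rk : r - k + k *+ 2 = r + k by rewrite mulr2n; ring.
rewrite rk wD w_r_m1 mul1r in J.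
rewrite mellin_cubicS mulrDr mulrCA J -[- 4%:R]mulN1r wM wN_m1.
transitivity (w k (-1) * w k (-1) * g (- (r
  + k)) * g (r - k) * (w (- k) 4%:R * g (k *+ 2) * J2 (w k) eta)
   + q * (nC * (k == h)%:R)); first by ring.
rewrite w_m1_sqr mul1r.
have -> : w (- k) 4%:R * g (k *+ 2) * J2 (w k) eta = g k ^+ 2 - nC * eta (-1) * (k == h)%:R.
  by rewrite gauss_sqr addrK.
(* At [k = h] the correction term of [gauss_sqr] cancels the extra term of the Mellin transform, so
   the formula has no exception. *)
have [->|_] := eqVneq k h; last by rewrite !mulr0 subr0 addr0; ring.
have -> : r - h = r + h by rewrite etaN.
have gg : g (- (r + h)) * g (r + h) = eta (-1) * q.
  by rewrite mulrC gaussN -e6D e6_eq0 mulr0 subr0 e6D wD w_r_m1 mul1r.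
rewrite !mulr1 -[RHS]mulrA gg.
rewrite gauss_eta_sqr.
transitivity (eta (-1) * eta (-1) * q ^+ 2); last by ring.
transitivity (eta (-1) * eta (-1) * (q ^+ 2 - q * nC) + q * nC); first by ring.
by rewrite w_m1_sqr; ring.
Qed.

(** The constant 1 changes the Mellin transform at the trivial character only, where it gives it the
    value 1, the same as for [cubicS]. *)
Definition cubicT (c : F) : algC := 1 + cubicE c.

Lemma mellin_cubicT k : mellin cubicT k = nC * (k == 0)%:R + mellin cubicE k.
Proof.
rewrite /mellin /cubicT; under eq_bigr do rewrite mulrDr mulr1.
by rewrite big_split sum_w_x.
Qed.

Lemma mellin_cubicT0 : mellin cubicT 0 = 1.
Proof.
rewrite mellin_cubicT eqxx mulr1 mellin_cubicE oppr0 !w_00 mul0rn.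
have -> : (27%:R != 0 :> F) by rewrite (natrM _ 3 9) (natrM _ 3 3) !mulf_neq0 ?three_neq0.
rewrite four_neq0 !mul1r [0 == _]eq_sym e6_eq0 mulr0 addr0.
have J00 : J2 (w 0) (w 0) = q - 2%:R.
  apply: (mulfI q_neq0); rewrite J2_gauss eqxx !mulr1 addr0 oppr0 gauss0 w_00 oppr_eq0 oner_eq0
    mul1r qE; ring.
have J0h : J2 (w 0) eta = -1.
  apply: (mulfI q_neq0); rewrite J2_gauss e6_eq0 mulr0 !add0r gauss0.
  transitivity (- (w h (-1) * (g h * g (- h)))); first by ring.
  by rewrite gaussN e6_eq0 mulr0 subr0 mulrA w_m1_sqr mul1r mulrN1.
by rewrite J00 J0h qE; ring.
Qed.

Lemma q_mellin_cubicT k : k != 0 ->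
  q * mellin cubicT k = w k (- 27%:R) * g (- (k *+ 3)) * g k ^+ 3.
Proof.
move=> k0; have J := J2_gauss k (k *+ 2); rewrite (negPf k0) mulr0 mul0r add0r -mulrS in J.
rewrite mellin_cubicT (negPf k0) mulr0 add0r mellin_cubicE -[- 27%:R]mulN1r wM.
transitivity (w k 27%:R * (w (- k) 4%:R * J2 (w k) eta) * (q * J2 (w k) (w (k *+ 2)))
  + q * (nC * (k == h)%:R)).
  by ring.
rewrite J (wMnS k 2) (_ : (-1) ^+ 3 = -1); last by ring.
transitivity (w k 27%:R * w k (-1) * g (- (k *+ 3)) * g k * (w (- k) 4%:R * g (k *+ 2) * J2 (w k)
  eta)
  + q * (nC * (k == h)%:R)); first by ring.
have -> : w (- k) 4%:R * g (k *+ 2) * J2 (w k) eta = g k ^+ 2 - nC * eta (-1) * (k == h)%:R.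
  by rewrite gauss_sqr addrK.
have [->|_] := eqVneq k h; last by rewrite !mulr0 subr0 addr0; ring.
have eta27 : eta 27%:R = eta (-1).
  rewrite (_ : 27%:R = 3%:R ^+ 2 * (-1 * - 3%:R)); last by ring.
  by rewrite etaM eta_sqr ?three_neq0 // etaM eta_m3 mul1r mulr1.
rewrite e6Mn -(e6_mod (3 * 3)) etaN -/eta eta27 !mulr1.
transitivity (eta (-1) * eta (-1) * (g h ^+ 2 * (g h ^+ 2 - nC * eta (-1))) + q * nC);
  first by ring.
rewrite gauss_eta_sqr.
transitivity (eta (-1) * eta (-1) * (eta (-1) * eta (-1)) * (q ^+ 2 - q * nC) + q * nC);
  first by ring.
transitivity (eta (-1) * eta (-1) * (g h ^+ 2) ^+ 2); last by ring.
rewrite gauss_eta_sqr.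
transitivity (eta (-1) * eta (-1) * (eta (-1) * eta (-1)) * q ^+ 2); last by ring.
by rewrite w_m1_sqr; ring.
Qed.

Lemma torsion3 k : (k *+ 3 == 0)%:R = (k == 0)%:R + (k == r)%:R + (k == e6 4)%:R :> algC.
Proof.
have := @torsion_sum 3 (2 * t) (fun j => (j == k)%:R) (mulnA 3 2 t).
rewrite (bigD1 k) //= eqxx mul1r big1 ?addr0 => [->|j /negPf->]; last by rewrite mul0r.
by rewrite !big_ord_recl big_ord0 addr0 /= addrA mul0n mul1n /bump /= mulnA ![_ == k]eq_sym.
Qed.

(** By the formulas above both sides are products of pairs g(a) g(-a), which [gaussN] evaluates. The
    exceptional values match: for k nonzero, 3 k = 0 holds exactly when k is [r] or [e6 4]. *)
Lemma mellin_cubic_norm k :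
  mellin cubicS k * mellin cubicS (- k) = mellin cubicT k * mellin cubicT (- k).
Proof.
have qq : q * q != 0 by rewrite mulf_neq0 ?q_neq0.
have [->|k0] := eqVneq k 0.
  rewrite oppr0 mellin_cubicT0; have : mellin cubicS 0 = 1; last by move=> ->.
  apply: (mulfI q_neq0); rewrite q_mellin_cubicS addr0 subr0 gauss0 -mulrA [g (- r) * _]mulrC.
  by rewrite gaussN e6_eq0 mulr0 subr0 w_r_m1; ring.
have nk0 : - k != 0 by rewrite oppr_eq0.
apply: (mulfI qq).
transitivity ((q * mellin cubicS k) * (q * mellin cubicS (- k))); first by ring.
transitivity ((q * mellin cubicT k) * (q * mellin cubicT (- k))); last by ring.
rewrite !q_mellin_cubicS !q_mellin_cubicT // opprK.
transitivity ((g k * g (- k)) ^+ 2 * (g (r + k) * g (- (r + k))) * (g (r - k) * g (- (r - k))));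
  first by ring.
transitivity (w k (- 27%:R) * w (- k) (- 27%:R) * (g k * g (- k)) ^+ 3 * (g (k *+ 3) * g (- (k *+
  3)))).
  2: by rewrite mulNrn opprK; ring.
have m27 : w k (- 27%:R) * w (- k) (- 27%:R) = 1.
  rewrite -wD subrr w_00 oppr_eq0 (_ : 27%:R = 3%:R * (3%:R * 3%:R) :> F); last by ring.
  by rewrite !mulf_neq0 ?three_neq0.
have rk : (r + k == 0) = (k == e6 4) by rewrite addrC addr_eq0 e6N.
have rk' : (r - k == 0) = (k == r) by rewrite subr_eq0 eq_sym.
rewrite m27 mul1r !gaussN !wD w_r_m1 !mul1r wN_m1 rk rk' torsion3 (negPf k0) add0r mulr0 subr0.
(* The two exceptional values are distinct, so the cross term of the product of the two corrections
   vanishes. *)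
have krk : (k == r)%:R * (k == e6 4)%:R = 0 :> algC.
  by case: eqVneq => [->|_]; rewrite ?mul0r // -subr_eq0 e6N // -e6D e6_eq0 mulr0.
transitivity (w k (-1) * w k (-1) * (w k (-1) * w k (-1)) * q ^+ 2
    * (q ^+ 2 - q * nC * ((k == r)%:R + (k == e6 4)%:R)
      + nC ^+ 2 * ((k == r)%:R * (k == e6 4)%:R))); first by ring.
rewrite krk w_m1_sqr.
transitivity (w k (-1) * w k (-1) * (w k (-1) * w k (-1)) * q ^+ 3
    * (q - nC * ((k == r)%:R + (k == e6 4)%:R))); last by ring.
by rewrite w_m1_sqr; ring.
Qed.

Lemma sum_cubic_sqr : \sum_(c | c != 0) cubicS c ^+ 2 = \sum_(c | c != 0) cubicT c ^+ 2.
Proof.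
apply: (mulfI n_neq0); rewrite -!mellin_parseval.
by apply: eq_bigr => k _; rewrite mellin_cubic_norm.
Qed.

(** At c = 1 the quadratic is (m + 1)^2, so only m = -1 is missing from a vanishing character sum.
    The value c = 1 is treated apart because the reflection of c in 1 - c sends it to 0. *)
Lemma cubicS1 : cubicS 1 = -1.
Proof.
have S : \sum_m w r m = 0 by rewrite sum_w_x e6_eq0 mulr0.
rewrite (bigD1 (-1)) //= w_r_m1 in S.
rewrite /cubicS (bigD1 (-1)) //= (_ : _ - _ * 1 = 0); last by ring.
rewrite eta0 mulr0 add0r; apply/eqP; rewrite -addr_eq0 addrC -[X in _ == X]S; apply/eqP.
congr (_ + _); apply: eq_bigr => m m1.
rewrite (_ : _ - _ * 1 = (m + 1) ^+ 2); last by ring.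
by rewrite eta_sqr ?mulr1 // addr_eq0.
Qed.

(** At c = 1 the quartic is (x - 1)^2 (x^2 - 4 x): the sum is the one for x^2 - 4 x without its term
    at x = 1, which is eta(-3) = 1. *)
Lemma cubicT1 : cubicT 1 = -1.
Proof.
have d : (- 4%:R) ^+ 2 - 4%:R * 0 != 0 :> F by rewrite mulr0 subr0 sqrrN expf_neq0 ?four_neq0.
have := sum_eta_quadratic d; rewrite (bigD1 1) //= (_ : _ + 0 = - 3%:R); last by ring.
rewrite eta_m3 => S; rewrite /cubicT /cubicE (bigD1 1) //= (_ : _ - _ = 0); last by ring.
rewrite eta0 add0r -[RHS]S; congr (_ + _); apply: eq_bigr => x x1.
rewrite (_ : _ - _ = (x - 1) ^+ 2 * (x ^+ 2 + - 4%:R * x + 0)); last by ring.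
by rewrite etaM eta_sqr ?mul1r // subr_eq0.
Qed.

(* Roots of x^2 - kx + 1 satisfy (x + 1)^2 = (k + 2) x and (x - 1)^2 = (k - 2) x. *)
Lemma sum_eta_inverse_pair (k : F) :
  \sum_x eta x * (x ^+ 2 + 1 == k * x)%:R = eta (k + 2%:R) + eta (k - 2%:R).
Proof.
have m1 : (-1 : F) != 1 by rewrite -subr_eq0 -opprD oppr_eq0 two_neq0.
have [->|k2] := eqVneq k 2%:R.
  rewrite subrr eta0 addr0 -natrD eta4 (bigD1 1) //= /eta w1x expr1n mulr1 -natr1 eqxx big1
    ?mulr1 ?addr0 //.
  move=> x x1; rewrite -subr_eq0 (_ : _ - _ = (x - 1) ^+ 2); last by ring.
  by rewrite expf_eq0 /= subr_eq0 (negPf x1) mulr0.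
have [->|k2'] := eqVneq k (- 2%:R).
  rewrite addNr eta0 add0r -opprD -natrD -[- 4%:R]mulN1r etaM eta4 (bigD1 (-1)) //= big1 => [|x x1].
    by rewrite sqrrN expr1n mulrN1 opprK -natr1 eqxx addr0.
  rewrite -subr_eq0 (_ : _ - _ = (x + 1) ^+ 2); last by ring.
  by rewrite expf_eq0 /= addr_eq0 (negPf x1) mulr0.
have kp : k + 2%:R != 0 by rewrite addr_eq0.
transitivity (eta (k + 2%:R) * \sum_x (1 * x ^+ 2 + - k * x + 1 == 0)%:R).
  rewrite mulr_sumr; apply: eq_bigr => x _.
  rewrite -subr_eq0 (_ : _ - _ = 1 * x ^+ 2 + - k * x + 1); last by ring.
  case: eqP => [xk|]; rewrite ?mulr0 // !mulr1.
  have x0 : x != 0 by apply/eqP => x0; move/eqP: xk; rewrite x0 expr2 !mulr0 !add0r oner_eq0.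
  have sq : (k + 2%:R) * x = (x + 1) ^+ 2.
    by apply/eqP; rewrite eq_sym -subr_eq0 -xk; apply/eqP; ring.
  have s0 : (x + 1) ^+ 2 != 0 by rewrite -sq mulf_neq0.
  apply: (mulfI (w_neq0 h kp)); rewrite -/eta -etaM sq eta_mul_self //.
  by apply: eta_sqr; move: s0; rewrite expf_eq0.
rewrite card_quadratic ?oner_eq0 // mulrDr mulr1; congr (_ + _).
rewrite (_ : _ - _ = (k + 2%:R) * (k - 2%:R)); last by ring.
by rewrite etaM mulrA eta_mul_self // mul1r.
Qed.

Lemma cubicSE c : cubicS c = \sum_m w r m * eta (m ^+ 2 + (4%:R * c - 2%:R) * m + 1).
Proof. by apply: eq_bigr => m _; congr (_ * eta _); ring. Qed.

(** The quadratic is palindromic: inverting m divides it by a square and conjugates the cubic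
    character. *)
Lemma cubicSE_inv c :
  cubicS c = \sum_m w (e6 4) m * eta (m ^+ 2 + (4%:R * c - 2%:R) * m + 1).
Proof.
rewrite cubicSE (reindex_inj invr_inj) /=; apply: eq_bigr => m _.
have [->|m0] := eqVneq m 0; first by rewrite invr0 !w0x !mul0r.
rewrite -wNV e6N //; congr (_ * _).
transitivity (eta (m^-1 ^+ 2 * (m ^+ 2 + (4%:R * c - 2%:R) * m + 1))).
  by congr eta; field.
by rewrite etaM eta_sqr ?mul1r // invr_eq0.
Qed.

(* Both sides are 2 + \sum_(x != 0) eta (x^6 + (4c - 2) x^3 + 1): in the variable
   x^3 the sum splits over the cubic characters, in the variable x + 1/x over the
   two factors of [sum_eta_inverse_pair]. *)
Lemma cubicS_cubicT_refl c : c != 0 -> c != 1 -> 2%:R * cubicS c = cubicT c + cubicT (1 - c).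
Proof.
move=> c0 c1; pose a := 4%:R * c - 2%:R.
pose G y := w 0 y * eta (y ^+ 2 + a * y + 1).
(* Chosen so that K(x + 1/x) = x^3 + a + x^(-3). *)
pose K k := k ^+ 3 - 3%:R * k + a.
have G0 : \sum_y G y = -2%:R.
  have disc : a ^+ 2 - 4%:R * 1 != 0.
    rewrite (_ : _ - _ = 4%:R * 4%:R * c * (c - 1)); last by rewrite /a; ring.
    by rewrite !mulf_neq0 ?four_neq0 ?subr_eq0.
  have := sum_eta_quadratic disc; rewrite (bigD1 0) //= expr2 !mulr0 !add0r eta1 => S.
  rewrite (bigD1 0) //= /G w0x mul0r add0r.
  transitivity (\sum_(y | y != 0) eta (y ^+ 2 + a * y + 1)).
    by apply: eq_bigr => y y0; rewrite w_00 y0 mul1r.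
  by apply: (addrI 1); rewrite S; ring.
have left : \sum_x G (x ^+ 3) = -2%:R + 2%:R * cubicS c.
  have Gw k y : G y * w k y = w k y * eta (y ^+ 2 + a * y + 1).
    by rewrite /G mulrAC -wD add0r.
  rewrite (@sum_comp_pow 3 (2 * t)) ?mulnA //; last by rewrite /G w0x mul0r.
  rewrite [2%:R * _]mulr_natl mulr2n [X in _ + (_
    + X)]cubicSE_inv cubicSE -G0 -big_split -big_split; apply: eq_bigr => y _.
  by rewrite !big_ord_recl big_ord0 addr0 /= /bump /= mul0n mul1n mulnA !mulrDr !Gw addrA.
have right : \sum_x G (x ^+ 3) = \sum_k eta (K k) * (eta (k + 2%:R) + eta (k - 2%:R)).
  transitivity (\sum_k \sum_x eta (K k) * (eta x * (x ^+ 2 + 1 == k * x)%:R)); last first.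
    by apply: eq_bigr => k _; rewrite -mulr_sumr sum_eta_inverse_pair.
  rewrite exchange_big; apply: eq_bigr => x _ /=.
  have [->|x0] := eqVneq x 0.
    rewrite /G expr0n w0x mul0r big1 // => k _; by rewrite eta0 mul0r mulr0.
  have kE k : (x ^+ 2 + 1 == k * x) = (k == x + x^-1).
    by rewrite -[RHS](inj_eq (mulIf x0)) mulrDl mulVf // -expr2 eq_sym.
  rewrite (bigD1 (x + x^-1)) //= kE eqxx mulr1 big1 ?addr0 => [|k kx];
    last by rewrite kE (negPf kx) !mulr0.
  rewrite /G w_00 expf_neq0 // mul1r [RHS]mulrC.
  transitivity (eta (x ^+ 2 * (x * K (x + x^-1)))); last by rewrite etaM eta_sqr // mul1r etaM.
  by congr eta; rewrite /K; field.
have := right; rewrite left; under eq_bigr do rewrite mulrDr.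
rewrite big_split /= => S; apply: (addrI (-2%:R)); rewrite S /cubicT /cubicE.
(* With k = x - 2 the product (k + 2) K(k) is the quartic of [cubicE (1 - c)]; with k = 2 - x the
   product (k - 2) K(k) is that of [cubicE c]. *)
rewrite [X in X + _ = _](reindex_inj (addIr (- 2%:R))) [X in _ + X
  = _](reindex_inj (subrI 2%:R)) /=.
transitivity (cubicE (1 - c) + cubicE c); last by rewrite /cubicE; ring.
by congr (_ + _); apply: eq_bigr => x _; rewrite -etaM; congr eta; rewrite /K /a; ring.
Qed.

Lemma cubicS_eq_cubicT c : c != 0 -> cubicS c = cubicT c.
Proof.
move=> c0; have [->|c1] := eqVneq c 1; first by rewrite cubicS1 cubicT1.
have real_T x : cubicT x \is Num.real.
  by rewrite rpredD ?rpred1 // rpred_sum // => y _; apply: eta_real.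
pose P (x : F) := (x != 0) && (x != 1).
have refl (f : F -> algC) : \sum_(x | P x) f (1 - x) = \sum_(x | P x) f x.
  rewrite [RHS](reindex_inj (subrI 1)) /=; apply: eq_bigl => x.
  have e1 : (1 - x == 1) = (x == 0) by rewrite -subr_eq0 addrAC subrr add0r oppr_eq0.
  by rewrite /P e1 subr_eq0 [1 == x]eq_sym andbC.
have sumST : \sum_(x | P x) cubicS x ^+ 2 = \sum_(x | P x) cubicT x ^+ 2.
  have := sum_cubic_sqr; rewrite (bigD1 1) ?oner_eq0 //= [in RHS](bigD1 1) ?oner_eq0 //=.
  by rewrite cubicS1 cubicT1 => /addrI.
(* Parallelogram law: the square is 2 T(x)^2 + 2 T(1 - x)^2 - 4 S(x)^2, and the three sums of
   squares agree. As [cubicT] is real, each square then vanishes. *)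
have sum0 : \sum_(x | P x) (cubicT x - cubicT (1 - x)) ^+ 2 = 0.
  transitivity (\sum_(x | P x) (2%:R * cubicT x ^+ 2
    + 2%:R * cubicT (1 - x) ^+ 2 - 4%:R * cubicS x ^+ 2)).
    apply: eq_bigr => x /andP[x0 x1]; have S := cubicS_cubicT_refl x0 x1.
    rewrite (_ : 4%:R * _ = (2%:R * cubicS x) ^+ 2); last by ring.
    by rewrite S; ring.
  rewrite sumrB big_split -!mulr_sumr (refl (fun x => cubicT x ^+ 2)) sumST /=; ring.
have /eqP := sum0; rewrite psumr_eq0 => [/allP/(_ c)|x _]; last first.
  by rewrite real_exprn_even_ge0 // rpredB.
rewrite mem_index_enum => /(_ isT); rewrite /P c0 c1 /= expf_eq0 /= subr_eq0 => /eqP T.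
by apply: (mulfI (_ : 2%:R != 0)); rewrite ?pnatr_eq0 // cubicS_cubicT_refl // -T mulr_natl.
Qed.

Lemma hasse_davenport3 k : g k * g (k + r) * g (k + e6 4) = w (- k) 27%:R * g (k *+ 3) * q.
Proof.
have gr : g r * g (e6 4) = q by rewrite -(@e6N 2) // gaussN e6_eq0 mulr0 subr0 w_r_m1 mul1r.
have [->|k0] := eqVneq k 0.
  rewrite !add0r -mulrA gr mul0rn oppr0 w_00 (_ : 27%:R = 3%:R * (3%:R * 3%:R)); last by ring.
  by rewrite !mulf_neq0 ?three_neq0 // mul1r.
have nk0 : - k != 0 by rewrite oppr_eq0.
(* The two functions agree off 0, so their transforms are equal; comparing them at [- k] leaves a
   common factor g(-k)^2 to cancel. *)
have := q_mellin_cubicT nk0; rewrite -(eq_mellin cubicS_eq_cubicT) q_mellin_cubicS.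
rewrite mulNrn !opprK opprB -(@e6N 2) // [r + _]addrC => E.
apply: (mulfI (expf_neq0 2 (gauss_neq0 (- k)))).
transitivity (g k * (g (- k) ^+ 2 * g (k - r) * g (k + r))); first by ring.
rewrite E -[- 27%:R]mulN1r wM wN_m1.
transitivity (w k (-1) * w (- k) 27%:R * g (k *+ 3) * g (- k) ^+ 2 * (g k * g (- k)));
  first by ring.
rewrite gaussN (negPf k0) mulr0 subr0.
transitivity (w k (-1) * w k (-1) * (w (- k) 27%:R * g (k *+ 3) * g (- k) ^+ 2 * q)); first by ring.
by rewrite w_m1_sqr; ring.
Qed.

(** The formula for 2 merges the factors j and j + 3; the three resulting Gauss sums, at 2 k shifted
    by the cubic characters, are merged by the formula for 3. *)
Lemma hasse_davenport6 k :
  \prod_(j < 6) g (k + e6 j) = w (- (k *+ 6)) 6%:R * g (k *+ 6) * (g h ^+ 3 * q).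
Proof.
have HD j : g (k + e6 j) * g (k + e6 (j + 3))
  = w (- (k + e6 j)) 4%:R * g (k *+ 2 + e6 (j * 2)) * g h.
  by rewrite e6D addrA hasse_davenport2 mulrnDl e6Mn.
transitivity ((g (k + e6 0) * g (k + e6 (0 + 3))) * (g (k + e6 1) * g (k + e6 (1 + 3))) * (g (k
  + e6 2) * g (k + e6 (2 + 3)))).
  by rewrite !big_ord_recl big_ord0 /bump /=; ring.
rewrite !HD mul0n e6_0 !addr0 mul1n.
transitivity (w (- k) 4%:R * w (- (k + e6 1)) 4%:R * w (- (k
  + r)) 4%:R * (g (k *+ 2) * g (k *+ 2 + r) * g (k *+ 2 + e6 4)) * g h ^+ 3).
  by ring.
rewrite hasse_davenport3 -mulrnA.
have eta14 : w (- e6 1) 4%:R * w (- r) 4%:R = 1.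
  by rewrite -wD -opprD -e6D etaN -/eta eta4.
(* This is 6^6 = 4^3 * 27^2. *)
have six : w (- (k *+ 6)) 6%:R = w (- k) 4%:R ^+ 3 * w (- (k *+ 2)) 27%:R.
  rewrite -!mulNrn (wMnS _ 5) (wMnS _ 1) -wX -wM; congr w; ring.
rewrite six (opprD k (e6 1)) (opprD k r) (wD (- k) (- e6 1)) (wD (- k) (- r));
  transitivity (w (- e6 1) 4%:R * w (- r) 4%:R * (w (- k) 4%:R ^+ 3 * w (- (k *+ 2)) 27%:R * g (k
    *+ 6) * (g h ^+ 3 * q))).
  by ring.
by rewrite eta14 mul1r.
Qed.
(** * The number of points in terms of Gauss sums *)

Lemma torsion6 (f : 'Z_n -> algC) :
  \sum_k f k * (k *+ 6 == 0)%:R = \sum_(j < 6) f (- e6 j).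
Proof.
rewrite -(torsion_sum (fun k => f (- k)) (erefl : (6 * t = n)%N)).
rewrite (reindex_inj oppr_inj); apply: eq_bigr => k _.
by rewrite mulNrn oppr_eq0.
Qed.

(** Multiplication by 6 is six-to-one from ['Z_n] onto its image, and [f] vanishes off the image. *)
Lemma sum_mul6 (f : 'Z_n -> algC) :
  (forall l, (forall k, k *+ 6 != l) -> f l = 0) ->
  \sum_k f (k *+ 6) = 6%:R * \sum_l f l.
Proof.
move=> f0; transitivity (\sum_l \sum_k f l * (k *+ 6 == l)%:R).
  rewrite exchange_big; apply: eq_bigr => k _.
  rewrite (bigD1 (k *+ 6)) //= eqxx mulr1 big1 ?addr0 // => l.
  by rewrite eq_sym => /negPf->; rewrite mulr0.
rewrite mulr_sumr; apply: eq_bigr => l _.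
have [/existsP[k /eqP <-]|/existsPn nk] := boolP [exists k : 'Z_n, k *+ 6 == l]; last first.
  by rewrite f0 ?mulr0 ?big1 // => k _; rewrite mul0r.
rewrite -mulr_sumr mulrC; congr (_ * _); rewrite (reindex_inj (addIr k)) /=.
transitivity (\sum_(i : 'Z_n) 1 * (i *+ 6 == 0)%:R : algC).
  by apply: eq_bigr => i _; rewrite mul1r mulrnDl -subr_eq0 addrK.
by rewrite (torsion6 (fun=> 1)) sumr_const card_ord.
Qed.

Lemma psi_fourier y : nC * (w 0 y * psi y) = \sum_k g (- k) * w k y.
Proof.
transitivity (\sum_x psi x * \sum_k w k (y / x)); last first.
  under eq_bigr do rewrite mulr_sumr.
  rewrite exchange_big; apply: eq_bigr => k _ /=; rewrite /gauss mulr_suml.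
  by apply: eq_bigr => x _; rewrite wM wNV; ring.
under eq_bigr do rewrite sum_w_k.
have [->|y0] := eqVneq y 0.
  by rewrite w0x mul0r mulr0 big1 // => x _; rewrite mul0r eq_sym oner_eq0 !mulr0.
rewrite w_00 y0 mul1r (bigD1 y) //= divff // eqxx mulr1 big1 ?addr0 1?mulrC // => x xy.
have [->|x0] := eqVneq x 0; first by rewrite invr0 mulr0 eq_sym oner_eq0 !mulr0.
by rewrite -[_ == 1](inj_eq (mulIf x0)) divfK // mul1r eq_sym (negPf xy) !mulr0.
Qed.

(** For z nonzero this is the sum of [w (k *+ 6) x * psi (z * x ^+ 6)] over x, with one term for
    each m such that 6 m = 6 k. *)
Definition pow6_sum (k : 'Z_n) (z : F) : algC :=
  \sum_(j < 6) g (k - e6 j) * w (- (k - e6 j)) z.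

Lemma sum_w_psi_pow6 l z : z != 0 ->
  \sum_x w l x * psi (z * x ^+ 6) = \sum_m g m * w (- m) z * (m *+ 6 == l)%:R.
Proof.
move=> z0; apply: (mulfI n_neq0); rewrite !mulr_sumr.
transitivity (\sum_x w l x * \sum_k g (- k) * w k (z * x ^+ 6)).
  apply: eq_bigr => x _; have [->|x0] := eqVneq x 0; first by rewrite w0x !mul0r mulr0.
  by rewrite -psi_fourier w_00 mulf_neq0 ?expf_neq0 // mul1r mulrCA.
under eq_bigr do rewrite mulr_sumr.
rewrite exchange_big (reindex_inj oppr_inj); apply: eq_bigr => k _ /=.
transitivity (g k * w (- k) z * \sum_x w (l - k *+ 6) x).
  rewrite mulr_sumr; apply: eq_bigr => x _.
  by rewrite opprK wM -(wMnS _ 5) mulNrn wD; ring.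
by rewrite sum_w_x subr_eq0 eq_sym; ring.
Qed.

Lemma sum_w_psi_pow6_mul6 k z : z != 0 ->
  \sum_x w (k *+ 6) x * psi (z * x ^+ 6) = pow6_sum k z.
Proof.
move=> z0; rewrite sum_w_psi_pow6 // (reindex_inj (addrI k)) /=.
rewrite /pow6_sum -(torsion6 (fun m => g (k + m) * w (- (k + m)) z)).
by apply: eq_bigr => m _; rewrite mulrnDl -subr_eq0 addrAC subrr add0r.
Qed.

Lemma sum_w_psi_pow6_eq0 l z : z != 0 -> (forall k, k *+ 6 != l) ->
  \sum_x w l x * psi (z * x ^+ 6) = 0.
Proof.
move=> z0 nl; rewrite sum_w_psi_pow6 // big1 // => m _.
by rewrite (negPf (nl m)) mulr0.
Qed.

Local Notation V := {ffun 'I_6 -> F}.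

Lemma sum_prod_ffun (f : F -> algC) : \sum_(v : V) \prod_i f (v i) = (\sum_x f x) ^+ 6.
Proof. by rewrite -(bigA_distr_bigA (fun _ x => f x)) prodr_const card_ord. Qed.

Lemma psi_sum (v : V) z : psi (z * \sum_i v i ^+ 6) = \prod_i psi (z * v i ^+ 6).
Proof.
rewrite mulr_sumr; apply: (big_morph psi psiD psi0).
Qed.

Lemma w_prod k (v : V) : w k (\prod_i v i) = \prod_i w k (v i).
Proof. exact: (big_morph (w k) (wM k) (w1x k)). Qed.

Section Points.
Variable lam : F.
Hypothesis lam_neq0 : lam != 0.

Definition on_X6 (v : V) := \sum_(i < 6) v i ^+ 6 == 6%:R * lam * \prod_(i < 6) v i.

(** The equation is detected by [psi], and z = 0 gives q^6. For the other z, the vectors with a zero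
    coordinate give the difference of two sixth powers, the summand 1 being the coordinate x = 0.
    The remaining vectors are expanded by [psi_fourier]; only characters that are sixth powers
    survive, each hit by six [k]. *)
Lemma q_affine_count :
  q * \sum_v (on_X6 v)%:R =
  q ^+ 6
  + (\sum_(z | z != 0) ((1 + pow6_sum 0 z) ^+ 6 - pow6_sum 0 z ^+ 6))
  + (6%:R * nC)^-1 * \sum_k g (- (k *+ 6)) * w (k *+ 6) (- (6%:R * lam)) *
      \sum_(z | z != 0) w (k *+ 6) z * pow6_sum k z ^+ 6.
Proof.
pose S (v : V) := \sum_i v i ^+ 6; pose P (v : V) := \prod_i v i.
pose c := - (6%:R * lam).
have c0 : c != 0 by rewrite oppr_eq0 mulf_neq0 ?six_neq0.
transitivity (\sum_z \sum_v psi (z * S v) * psi (z * c * P v)).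
  rewrite exchange_big mulr_sumr; apply: eq_bigr => v _ /=.
  rewrite /on_X6 -subr_eq0 -sum_psiM; apply: eq_bigr => z _.
  by rewrite -psiD; congr psi; rewrite /S /P /c; ring.
rewrite (bigD1 0) //= -!addrA; congr (_ + _).
  rewrite (eq_bigr (fun=> 1)) => [|v _]; last by rewrite !mul0r psi0 mulr1.
  by rewrite sumr_const card_ffun card_ord -[LHS]/((_ ^ _)%:R) natrX.
have split z : z != 0 -> \sum_v psi (z * S v) * psi (z * c * P v) =
   (1 + pow6_sum 0 z) ^+ 6 - pow6_sum 0 z ^+ 6
   + nC^-1 * \sum_l g (- l) * w l c * (w l z * (\sum_x w l x * psi (z * x ^+ 6)) ^+ 6).
  move=> z0.
  transitivity (\sum_v psi (z * S v) - \sum_v w 0 (P v) * psi (z * S v)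
      + \sum_v psi (z * S v) * (w 0 (P v) * psi (z * c * P v))).
    rewrite -sumrB -big_split; apply: eq_bigr => v _ /=.
    rewrite w_00; case: eqP => [->|_]; last by rewrite !mul1r subrr add0r.
    by rewrite !mulr0 psi0 !mul0r subr0 mulr0 addr0 mulr1.
  have P0 : \sum_x w 0 x * psi (z * x ^+ 6) = pow6_sum 0 z.
    by rewrite -(sum_w_psi_pow6_mul6 0 z0) mul0rn.
  congr (_ - _ + _).
  - under eq_bigr do rewrite psi_sum.
    rewrite (sum_prod_ffun (fun x => psi (z * x ^+ 6))); congr (_ ^+ _).
    rewrite (bigD1 0) //= expr0n mulr0 psi0 -P0 [in RHS](bigD1 0) //= w0x mul0r add0r.
    by congr (_ + _); apply: eq_bigr => x x0; rewrite w_00 x0 mul1r.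
  - under eq_bigr do rewrite psi_sum w_prod -big_split.
    by rewrite (sum_prod_ffun (fun x => w 0 x * psi (z * x ^+ 6))) P0.
  apply: (mulfI n_neq0); rewrite mulVKf ?n_neq0 // mulr_sumr.
  transitivity (\sum_v psi (z * S v) * \sum_l g (- l) * w l (z * c * P v)).
    apply: eq_bigr => v _; rewrite -psi_fourier !w_00 !mulf_eq0 (negPf z0) (negPf c0) /=; ring.
  under eq_bigr do rewrite mulr_sumr.
  rewrite exchange_big; apply: eq_bigr => l _ /=.
  rewrite -(sum_prod_ffun (fun x => w l x * psi (z * x ^+ 6))) !mulr_sumr.
  by apply: eq_bigr => v _; rewrite big_split /= -psi_sum -w_prod !wM -/(S v) -/(P v); ring.
transitivity (\sum_(z | z != 0) ((1 + pow6_sum 0 z) ^+ 6 - pow6_sum 0 z ^+ 6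
   + nC^-1 * \sum_l g (- l) * w l c * (w l z * (\sum_x w l x * psi (z * x ^+ 6)) ^+ 6))).
  exact: eq_bigr.
rewrite big_split /=; congr (_ + _); rewrite -mulr_sumr exchange_big invfM /=.
rewrite [6%:R^-1 * _]mulrC -mulrA; congr (_ * _).
have six0 : 6%:R != 0 :> algC by rewrite pnatr_eq0.
apply: (mulfI six0); rewrite mulVKf // -sum_mul6 => [|l nl]; last first.
  by rewrite big1 // => z z0; rewrite sum_w_psi_pow6_eq0 // expr0n !mulr0.
apply: eq_bigr => k _; rewrite -mulr_sumr; congr (_ * _).
by apply: eq_bigr => z z0; rewrite sum_w_psi_pow6_mul6.
Qed.

(** * From affine to projective points *)

Definition dilate (c : F) (v : V) : V := [ffun i => c * v i].

Lemma dilateK c : c != 0 -> cancel (dilate c) (dilate c^-1).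
Proof. by move=> c0 v; apply/ffunP => i; rewrite !ffunE mulKf. Qed.

Lemma on_X6_dilate c v : c != 0 -> on_X6 (dilate c v) = on_X6 v.
Proof.
move=> c0; rewrite /on_X6; under eq_bigr do rewrite ffunE exprMn.
under [\prod_i _]eq_bigr do rewrite ffunE.
rewrite -mulr_sumr big_split prodr_const card_ord /= mulrCA.
by rewrite (inj_eq (mulfI (expf_neq0 6 c0))).
Qed.

Lemma proj_rep_neq0 (v : V) : proj_rep v -> v != [ffun=> 0].
Proof.
move=> /existsP[i /andP[/eqP vi _]]; apply/eqP => v0.
by move/eqP: vi; rewrite v0 ffunE eq_sym oner_eq0.
Qed.

(** The only scalar that normalizes [v] is the inverse of its first nonzero coordinate. *)
Lemma proj_rep_unique (v : V) : v != [ffun=> 0] ->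
  \sum_(c | c != 0) (proj_rep (dilate c v))%:R = 1 :> algC.
Proof.
move=> v0; have [i1 vi1] : exists i, v i != 0.
  apply/existsP; apply: contraNT v0 => /existsPn v0.
  by apply/eqP/ffunP => i; rewrite ffunE; apply/eqP; have := v0 i; rewrite negbK.
have [i vi lt_i] := @arg_minnP 'I_6 i1 (fun i => v i != 0) val vi1.
have repE c : c != 0 -> proj_rep (dilate c v) = (c == (v i)^-1).
  move=> c0; rewrite -(inj_eq (mulIf vi)) mulVf //.
  apply/existsP/idP => [[j /andP[]]|cv].
    rewrite ffunE => cvj /forallP jmin.
    have vj : v j != 0 by apply: contraTneq cvj => ->; rewrite mulr0 eq_sym oner_eq0.
    have [ij|ji|/val_inj ->//] := ltngtP i j.
      have := jmin i; rewrite ij ffunE /= mulf_eq0 (negPf c0) (negPf vi) //.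
    by have := lt_i j vj; rewrite leqNgt ji.
  exists i; rewrite ffunE cv /=; apply/forallP => j; apply/implyP => ji.
  rewrite ffunE mulf_eq0 (negPf c0) /=; apply: contraTT ji => vj.
  by rewrite -leqNgt lt_i.
rewrite (bigD1 (v i)^-1) ?invr_eq0 //= repE ?invr_eq0 // eqxx big1 ?addr0 // => c /andP[c0 cv].
by rewrite repE // (negPf cv).
Qed.

(** The 1 is the zero vector. Nonzero solutions are weighted by the sum of [proj_rep_unique]; after
    exchanging sums every scalar contributes the number of normalized solutions, because dilation
    permutes the solutions. *)
Lemma X6_points_affine : \sum_v (on_X6 v)%:R = 1 + nC * (X6_points lam)%:R.
Proof.
rewrite (bigD1 [ffun=> 0]) //=; congr (_ + _).
  rewrite /on_X6 big1 => [|i _]; last by rewrite ffunE expr0n.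
  by rewrite (bigD1 ord0) //= ffunE mul0r mulr0 eqxx.
transitivity (\sum_(v : V | v != [ffun=> 0]) \sum_(c | c != 0) (proj_rep (dilate c v) && on_X6
  v)%:R : algC).
  apply: eq_bigr => v v0; rewrite -[LHS]mul1r -[X in X * _](proj_rep_unique v0) mulr_suml.
  by apply: eq_bigr => c _; rewrite -natrM mulnb.
rewrite exchange_big /=.
have card_n0 : nC = \sum_(c : F | c != 0) 1 by rewrite sumr_const cardC1 cardF.
rewrite card_n0 mulr_suml; apply: eq_bigr => c c0; rewrite mul1r.
have c0' : c^-1 != 0 by rewrite invr_eq0.
rewrite (reindex_onto (dilate c^-1) (dilate c)) /= => [|v _]; last exact: dilateK.
rewrite /X6_points -sum1_card natr_sum big_mkcond [RHS]big_mkcond /=; apply: eq_bigr => v _.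
have dK : dilate c (dilate c^-1 v) = v by rewrite -{1}[c]invrK dilateK.
rewrite dK eqxx andbT inE on_X6_dilate // -/(on_X6 v).
have [rep|] := boolP (proj_rep v) => /=; last by case: ifP.
have -> : dilate c^-1 v != [ffun=> 0].
  apply: contra (proj_rep_neq0 rep) => /eqP d0; rewrite -dK d0; apply/eqP/ffunP => i.
  by rewrite !ffunE mulr0.
by case: (on_X6 v).
Qed.

(** * Words of zero sum and their Gauss sums *)

Fixpoint words (m : nat) : seq (seq nat) :=
  if m is m'.+1 then [seq a :: s | a <- iota 0 6, s <- words m'] else [:: [::]].

Definition zero_words := [seq s <- words 6 | sumn s %% 6 == 0]%N.

Lemma words_size m s : s \in words m -> size s = m /\ all (fun a => a < 6)%N s.
Proof.
elim: m s => [|m IH] s; first by rewrite inE => /eqP->.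
move=> /allpairsP[[a s'] []]; rewrite mem_iota => /andP[_ a6] /IH[szs s6] ->.
by split; [rewrite /= szs | rewrite /= s6 andbT].
Qed.

Lemma expr_words (Y : nat -> algC) m :
  (\sum_(j < 6) Y j) ^+ m = \sum_(s <- words m) \prod_(a <- s) Y a.
Proof.
elim: m => [|m IH]; first by rewrite big_seq1 big_nil.
rewrite exprS IH big_allpairs_dep mulr_suml -[iota 0 6]/(index_iota 0 6) big_mkord.
by apply: eq_bigr => j _; rewrite mulr_sumr; apply: eq_bigr => s _; rewrite big_cons.
Qed.

Definition E6 (X : nat -> algC) : algC := \sum_(s <- zero_words) \prod_(a <- s) X a.

Lemma eq_E6 X Y : (forall j, (j < 6)%N -> X j = Y j) -> E6 X = E6 Y.
Proof.
move=> XY; apply: eq_big_seq => s; rewrite mem_filter => /andP[_ /words_size[_ /allP s6]].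
by apply: eq_big_seq => a /s6 /XY.
Qed.

(** In the expanded power a word carries the character [e6] of its sum minus 6 k. The twist by
    [k *+ 6] removes the second part, and orthogonality in z keeps the words of zero sum. *)
Lemma E6_char (X : nat -> algC) (k : 'Z_n) :
  \sum_(z | z != 0) w (k *+ 6) z * (\sum_(j < 6) X j * w (- (k - e6 j)) z) ^+ 6 = nC * E6 X.
Proof.
have prodw z (s : seq nat) : z != 0 -> \prod_(a <- s) (X a * w (- (k - e6 a)) z) =
    \prod_(a <- s) X a * w (e6 (sumn s) - k *+ size s) z.
  move=> z0; elim: s => [|a s IH]; first by rewrite !big_nil subr0 w_00 z0 mulr1.
  rewrite !big_cons IH /= e6D mulrS.
  have -> : e6 a + e6 (sumn s) - (k + k *+ size s)
    = - (k - e6 a) + (e6 (sumn s) - k *+ size s) by ring.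
  by rewrite (wD (- (k - e6 a))); ring.
have EW Y := expr_words Y 6; have SW := @words_size 6.
rewrite /E6 /zero_words; move: (words 6) EW SW => ws EW SW.
transitivity (\sum_z \sum_(s <- ws) \prod_(a <- s) X a * w (e6 (sumn s)) z).
  rewrite [LHS]big_mkcond; apply: eq_bigr => z _ /=.
  have [->|z0 /=] := eqVneq z 0; first by rewrite /= big1 // => s _; rewrite w0x mulr0.
  rewrite (EW (fun j => X j * w (- (k - e6 j)) z)) mulr_sumr; apply: eq_big_seq => s /SW[szs _].
  rewrite prodw // szs wD [w (- _) z]wN mulrCA [w (k *+ 6) z * _]mulrCA divff ?w_neq0 //.
  by rewrite mulr1.
rewrite exchange_big /= big_filter mulr_sumr [RHS]big_mkcond /=.
apply: eq_bigr => s _; rewrite -mulr_sumr sum_w_x e6_eq0.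
by case: ifP => _; rewrite ?mulr0 // mulr1 mulrC.
Qed.

(** For a shift by one, [E6_char] at the exponents 0 and [e6 1], both killed by 6, turns the two
    sides into the same sum with its six terms rotated. *)
Lemma E6_shift (X : nat -> algC) i : (forall j, X (j + 6)%N = X j) -> E6 (fun j =>
  X (j + i)%N) = E6 X.
Proof.
elim: i X => [|i IH] X perX; first by apply: eq_E6 => j _; rewrite addn0.
rewrite -(IH _ perX); have perY j : X (j + 6 + i)%N = X (j + i)%N by rewrite addnAC perX.
apply: (mulfI n_neq0); rewrite -(E6_char _ 0) -(E6_char _ (e6 1)) mul0rn e6Mn e6_6.
apply: eq_bigr => z z0; congr (_ * _ ^+ _).
rewrite [LHS]big_ord_recr [RHS]big_ord_recl /= addrC; congr (_ + _).
  by rewrite -addSnnS (_ : 6 + i = 0 + 6 + i)%N // perY sub0r opprK e6_0 subr0 e6N.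
apply: eq_bigr => j _; rewrite /bump /= add1n addSnnS; congr (_ * w _ _).
by rewrite sub0r opprK -[j.+1]add1n e6D opprD opprK addKr.
Qed.

Lemma prod_count (Y : nat -> algC) s : all (fun a => a < 6)%N s ->
  \prod_(a <- s) Y a = \prod_(j < 6) Y j ^+ count_mem (val j) s.
Proof.
elim: s => [|a s IH] /=; first by rewrite big_nil big1.
move=> /andP[a6 s6]; rewrite big_cons IH // (bigD1 (Ordinal a6)) //= [RHS](bigD1 (Ordinal a6)) //=.
rewrite mulrA; congr (_ * _); first by rewrite eqxx exprS.
apply: eq_bigr => j ja; have -> // : (a == j) = false.
by apply/negbTE; apply: contra ja => /eqP aj; apply/eqP/val_inj.
Qed.

(* The contribution of a letter of multiplicity m to the quotient of the six distinct
   Gauss sums by those of a word. The power of [corr] is m - 1 and not m: this is what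
   the degenerate characters and the points with a zero coordinate add up to. *)
Definition local_factor (k : 'Z_n) (m : nat) : algC :=
  if m is m'.+1 then (corr k / g k) ^+ m' else g k.

Definition word_factor (s : seq nat) (k : 'Z_n) : algC :=
  \prod_(j < 6) local_factor (k + e6 j) (count_mem (val j) s).

(** This is g(-k) without its sign; over a word of zero sum the signs multiply to 1, by
    [E6_sign]. *)
Definition opp_gauss (k : 'Z_n) : algC := q * corr k / g k.

Lemma gauss_opp_gauss k : g (- k) = w k (-1) * opp_gauss k.
Proof. by rewrite gauss_opp /opp_gauss; ring. Qed.

(** A letter of multiplicity m >= 1 contributes g (q corr / g)^m = q^m corr (corr / g)^(m - 1), so
    one factor [corr] is left over for each letter that occurs. *)
Lemma word_factorE s k : s \in zero_words ->
  q ^+ 6 * word_factor s k * (\prod_(j < 6 | val j \in s) corr (k + e6 j)) =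
  \prod_(j < 6) g (k + e6 j) * \prod_(a <- s) opp_gauss (k + e6 a).
Proof.
rewrite mem_filter => /andP[_ /words_size[szs s6]].
have -> : q ^+ 6 = \prod_(a <- s) q by rewrite big_const_seq count_predT szs -Monoid.iteropE.
rewrite /word_factor (prod_count (fun=> q)) // (prod_count (fun a => opp_gauss (k + e6 a))) //.
rewrite [X in _ * X = _]big_mkcond -!big_split /=; apply: eq_bigr => j _ /=.
rewrite -has_pred1 has_count; case: (count_mem _ s) => [|m] /=.
  by rewrite !expr0 mul1r !mulr1.
by rewrite /opp_gauss !exprMn !exprSr exprVn; field; rewrite expf_neq0 gauss_neq0.
Qed.

Lemma e6_inj i j : (i < 6)%N -> (j < 6)%N -> e6 i = e6 j -> i = j.
Proof.
move=> i6 j6 /eqP; rewrite -subr_eq0 e6N ?(ltnW j6) // -e6D e6_eq0 => /eqP; lia.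
Qed.

(** At most one j satisfies k + e6 j = 0. If that letter occurs, the product is 1/q and the other
    factor is 1 + (q - 1); otherwise both are 1. *)
Lemma prod_corr (s : seq nat) k :
  (\prod_(j < 6 | val j \in s) corr (k + e6 j)) *
  (1 + nC * \sum_(j < 6) ((k + e6 j == 0) && (val j \in s))%:R) = 1.
Proof.
have [/existsP[j /eqP kj]|/existsPn nk] := boolP [exists j : 'I_6, k + e6 j == 0]; last first.
  rewrite !big1 ?mulr0 ?addr0 ?mulr1 // => j _; first by rewrite (negPf (nk j)).
  exact: corr1.
have other (i : 'I_6) : i != j -> k + e6 i != 0.
  apply: contra => /eqP ki; apply/eqP/val_inj; apply: e6_inj => //=.
  by apply: (addrI k); rewrite ki kj.
rewrite big_mkcond (bigD1 j) //= [\sum_(i < 6) _](bigD1 j) //= kj eqxx corr0.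
rewrite !big1 => [|i ij|i ij]; last by rewrite corr1 ?if_same ?other.
  by case: (_ \in s); rewrite /= mulr1 addr0 ?mulr0 ?addr0 ?mulr1 // addrC -qE mulVf ?q_neq0.
by rewrite (negPf (other i ij)).
Qed.

Lemma prod_drop (Y : nat -> algC) j s :
  \prod_(a <- s) (Y a * (a != j)%:R) = \prod_(a <- s) Y a * (1 - (j \in s)%:R).
Proof.
rewrite big_split /=; congr (_ * _); elim: s => [|a s IH]; first by rewrite big_nil subr0.
rewrite big_cons IH inE eq_sym; case: eqP => _ /=; first by rewrite mul0r subrr.
by rewrite mul1r.
Qed.

Local Notation opp_coord k := (fun a : nat => opp_gauss (k + e6 a)).

(** [prod_corr] inverts the left-over [corr] factors. The words that contain the degenerate letter j
    are all words minus those avoiding j, which [prod_drop] selects. *)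
Lemma sum_word_factor k :
  q ^+ 6 * \sum_(s <- zero_words) word_factor s k =
  \prod_(j < 6) g (k + e6 j) * (E6 (opp_coord k) +
    nC * \sum_(j < 6) (k + e6 j == 0)%:R *
      (E6 (opp_coord k) - E6 (fun a => opp_gauss (k + e6 a) * (a != j)%:R))).
Proof.
transitivity (\sum_(s <- zero_words) (\prod_(j < 6) g (k + e6 j) *
   (\prod_(a <- s) opp_gauss (k + e6 a) *
     (1 + nC * \sum_(j < 6) ((k + e6 j == 0) && (val j \in s))%:R)))).
  rewrite mulr_sumr; apply: eq_big_seq => s /(word_factorE k) E.
  by rewrite mulrA -E -mulrA prod_corr mulr1.
rewrite -mulr_sumr; congr (_ * _); under eq_bigr do rewrite mulrDr mulr1.
rewrite big_split /=; congr (_ + _).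
under eq_bigr do rewrite mulrCA mulr_sumr.
rewrite -mulr_sumr exchange_big; congr (_ * _); apply: eq_bigr => j _ /=.
rewrite /E6 -sumrB mulr_sumr; apply: eq_bigr => s _.
rewrite prod_drop; case: (k + _ == 0) => /=; last by rewrite mulr0 mul0r.
by case: (_ \in s); rewrite ?mulr1 ?mulr0 /=; ring.
Qed.

(** Shifting all letters by j moves the degenerate letter to 0, so the six degenerate characters
    have the same correction. *)
Lemma opp_coord_shift k j : (j < 6)%N -> k + e6 j = 0 ->
  E6 (opp_coord k) = E6 (opp_coord 0) /\
  E6 (fun a => opp_gauss (k + e6 a) * (a != j)%:R) =
  E6 (fun a => opp_gauss (0 + e6 a) * (a != 0%N)%:R).
Proof.
move=> j6 kj; have per a : e6 (a + 6) = e6 a by rewrite e6D e6_6 addr0.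
split.
  rewrite -(@E6_shift _ j) => [|a]; last by rewrite per.
  by apply: eq_E6 => a _; rewrite [(a + j)%N]addnC e6D addrA kj.
rewrite (@eq_E6 _ (fun a => opp_gauss (k + e6 a) * (a %% 6 != j)%N%:R)); last first.
  by move=> a a6; rewrite modn_small.
rewrite -(@E6_shift _ j) => [|a]; last by rewrite per modnDr.
apply: eq_E6 => a a6; rewrite [(a + j)%N]addnC e6D addrA kj; congr (_ * (~~ _)%:R).
by rewrite -{2}[j](modn_small j6) -{2}[j]addn0 eqn_modDl modn_small.
Qed.

Lemma E6_sign k X : E6 (fun a => w (k + e6 a) (-1) * X a) = E6 X.
Proof.
apply: eq_big_seq => s; rewrite mem_filter => /andP[s0 /words_size[szs _]].
have m1 : (-1 : F) != 0 by rewrite oppr_eq0 oner_eq0.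
rewrite big_split /=; have -> : \prod_(a <- s) w (k + e6 a) (-1)
  = w (k *+ size s + e6 (sumn s)) (-1).
  elim: (s) => [|a s' IH]; first by rewrite big_nil addr0 w_00 m1.
  by rewrite big_cons IH /= e6D mulrS -wD; congr w; ring.
have -> : e6 (sumn s) = 0 by apply/eqP; rewrite e6_eq0.
by rewrite szs addr0 (wMnS k 5) -signr_odd expr0 w1x mul1r.
Qed.

Lemma word_formula :
  q * \sum_v (on_X6 v)%:R =
  q ^+ 6 + (6%:R * (g h ^+ 3 * q))^-1 *
    \sum_k w k (lam ^+ 6)^-1 * (q ^+ 6 * \sum_(s <- zero_words) word_factor s k).
Proof.
pose C := g h ^+ 3 * q; pose H k := \prod_(j < 6) g (k + e6 j).
pose Y := E6 (opp_coord 0); pose Z := E6 (fun a => opp_gauss (0 + e6 a) * (a != 0%N)%:R).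
have C0 : C != 0 by rewrite mulf_neq0 ?q_neq0 // expf_neq0 // gauss_neq0.
have w_lam k : k *+ 6 = 0 -> w k (lam ^+ 6)^-1 = 1.
  by move=> k6; rewrite -exprVn -(wMnS k 5) k6 w_00 invr_eq0 lam_neq0.
(* Only the six [k] with 6 k = 0 contribute. There [H k] is C g(0) = -C, hence the sign of Z - Y. *)
have bdry : \sum_k w k (lam ^+ 6)^-1 * (H k * (nC * \sum_(j < 6) (k + e6 j == 0)%:R *
      (E6 (opp_coord k) - E6 (fun a => opp_gauss (k + e6 a) * (a != j)%:R))))
        = 6%:R * C * nC * (Z - Y).
  transitivity (\sum_(j < 6) \sum_k (k + e6 j == 0)%:R * (C * nC * (Z - Y))).
    rewrite exchange_big; apply: eq_bigr => k _ /=; rewrite !mulr_sumr; apply: eq_bigr => j _.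
    have [kj|_] := eqVneq (k + e6 j) 0; last by rewrite !mul0r !mulr0.
    have [-> ->] := opp_coord_shift (ltn_ord j) kj; have k6 : k *+ 6 = 0.
      by move/eqP: kj; rewrite addr_eq0 => /eqP ->; rewrite mulNrn e6Mn -e6_mod modnMl oppr0.
    rewrite w_lam // /H hasse_davenport6 k6 oppr0 w_00 six_neq0 gauss0 -/C -/Y -/Z !mul1r; ring.
  transitivity (\sum_(j < 6) C * nC * (Z - Y)).
    apply: eq_bigr => j _; rewrite (bigD1 (- e6 j)) //= addNr eqxx mul1r big1 ?addr0 // => k.
    by rewrite -addr_eq0 => /negPf ->; rewrite mul0r.
  by rewrite sumr_const card_ord -[LHS]mulr_natl; ring.
transitivity (q ^+ 6 + nC * (Z - Y)
  + (6%:R * C)^-1 * \sum_k w k (lam ^+ 6)^-1 * (H k * E6 (opp_coord k))); last first.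
  rewrite -addrA; congr (_ + _); under [in RHS]eq_bigr do rewrite sum_word_factor mulrDr mulrDr.
  rewrite -/C big_split /= bdry [RHS]mulrDr [LHS]addrC; congr (_ + _).
  by field; rewrite C0.
rewrite q_affine_count; congr (_ + _ + _).
  have pow0 z : pow6_sum 0 z = \sum_(j < 6) g (- e6 j) * w (- (0 - e6 j)) z.
    by apply: eq_bigr => j _; rewrite sub0r.
  rewrite sumrB mulrBr; congr (_ - _).
    (* As g(0) = -1, the summand 1 cancels the term j = 0 of [pow6_sum 0 z]: the zero coordinates
       amount to dropping the letter 0. *)
    rewrite /Z -(@E6_sign 0) -(E6_char _ 0); apply: eq_bigr => z z0.
    rewrite mul0rn w_00 z0 mul1r; congr (_ ^+ _);
      rewrite pow0 big_ord_recl [RHS]big_ord_recl /= e6_0 !addr0 subr0 oppr0.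
    rewrite !w_00 z0 gauss0 !mulr0 mul0r mulr1 addrA subrr.
    by congr (_ + _); apply: eq_bigr => j _; rewrite !add0r mulr1 gauss_opp_gauss.
  rewrite /Y -(@E6_sign 0) -(E6_char _ 0); apply: eq_bigr => z z0.
  rewrite mul0rn w_00 z0 mul1r pow0; congr (_ ^+ _).
  by apply: eq_bigr => j _; rewrite !add0r gauss_opp_gauss.
pose A := \sum_k g (- (k *+ 6)) * w (k *+ 6) (- (6%:R * lam)) * \sum_(z | z != 0) w (k *+ 6) z *
  pow6_sum k z ^+ 6.
(* The constant [C] is inserted so that [hasse_davenport6] can turn C g(6 k) into the product of six
   Gauss sums. *)
rewrite -/A; transitivity ((6%:R * C)^-1 * (C * (nC^-1 * A))).
  have cancel_mid (a b c y : algC) : c != 0 -> (a * b)^-1 * y = (a * c)^-1 * (c * (b^-1 * y)).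
    by move=> c0; rewrite !invfM -!mulrA mulKf.
  exact: cancel_mid.
congr (_ * _); rewrite /A !mulr_sumr (reindex_inj oppr_inj); apply: eq_bigr => k _ /=.
rewrite (E6_char (fun j => g (- k - e6 j)) (- k)) (@eq_E6 _ (fun a =>
  w (k + e6 a) (-1) * opp_gauss (k + e6 a))); last first.
  by move=> a _; rewrite -opprD gauss_opp_gauss.
rewrite (E6_sign k (opp_coord k)) /H hasse_davenport6 mulNrn opprK -/C.
have -> : w (- (k *+ 6)) (- (6%:R * lam)) = w (- (k *+ 6)) 6%:R * w k (lam ^+ 6)^-1.
  rewrite -mulNrn !(wMnS _ 5) exprNn -signr_odd expr0 mul1r exprMn wM.
  by rewrite [w (- k) (lam ^+ 6)]wNV.
transitivity (nC^-1 * nC * (w k (lam ^+ 6)^-1 * (w (- (k *+ 6)) 6%:R * g (k *+ 6) * C * E6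
  (opp_coord k)))); first by ring.
by rewrite mulVf ?n_neq0 // mul1r.
Qed.

(** * Rotation classes of words *)

Definition mult_vec (s : seq nat) : seq nat := [seq count_mem j s | j <- iota 0 6].

(* One multiplicity vector for each orbit under cyclic rotation, rotated so that the
   zero entries and the excess entries are the upper and lower parameters of the
   corresponding hypergeometric function. *)
Definition orbit_reps : seq (seq nat) :=
  [:: [:: 6; 0; 0; 0; 0; 0]; [:: 4; 1; 0; 0; 0; 1]; [:: 4; 0; 1; 0; 1; 0];
      [:: 4; 0; 0; 2; 0; 0]; [:: 3; 0; 3; 0; 0; 0]; [:: 3; 0; 1; 0; 0; 2];
      [:: 3; 2; 0; 0; 1; 0]; [:: 2; 2; 2; 0; 0; 0]; [:: 2; 0; 2; 0; 2; 0];
      [:: 3; 0; 0; 1; 1; 1]; [:: 3; 1; 1; 1; 0; 0]; [:: 2; 1; 0; 2; 0; 1];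
      [:: 2; 1; 0; 1; 2; 0]; [:: 2; 1; 1; 0; 1; 1]]%N.

Definition orbit_index (m : seq nat) : nat :=
  find (fun r0 => r0 \in [seq rot i m | i <- iota 0 6]) orbit_reps.

Definition orbit_indices := [seq orbit_index (mult_vec s) | s <- zero_words].

(** The counts add up to 6^5, the number of words of zero sum, and are six times the absolute values
    of the coefficients in the formula. *)
Lemma orbit_counts :
  [seq count_mem i orbit_indices | i <- iota 0 14] =
  [:: 6; 180; 180; 90; 120; 360; 360; 540; 180; 720; 720; 1080; 1080; 2160]%N.
Proof. by vm_compute. Qed.

(** As [find] returns 14 on failure, the bound says that every word belongs to one of the listed
    classes. *)
Lemma orbit_indices_lt : all (fun i => i < 14)%N orbit_indices.
Proof. by vm_compute. Qed.

Definition vec_sum (m : seq nat) : algC :=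
  \sum_k w k (lam ^+ 6)^-1 * \prod_(j < 6) local_factor (k + e6 j) (nth 0%N m j).

Lemma vec_sum_mult s :
  vec_sum (mult_vec s) = \sum_k w k (lam ^+ 6)^-1 * word_factor s k.
Proof.
apply: eq_bigr => k _; congr (_ * _); apply: eq_bigr => j _.
by rewrite (nth_map 0%N) ?size_iota // nth_iota.
Qed.

(** Shifting the summation index by [e6 5] rotates the factors and leaves the character value alone,
    because its argument is a sixth power. *)
Lemma vec_sum_rot1 m : size m = 6 -> vec_sum (rot 1 m) = vec_sum m.
Proof.
case: m => [|a m] // [sz]; rewrite rot1_cons /vec_sum [RHS](reindex_inj (addIr (e6 5))) /=.
apply: eq_bigr => k _; congr (_ * _).
  by rewrite wD -exprVn -(wMnS (e6 5) 5) e6Mn -e6_mod w_00 invr_eq0 lam_neq0 mulr1.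
rewrite big_ord_recr [RHS]big_ord_recl /= mulrC nth_rcons sz ltnn eqxx; congr (_ * _).
  by rewrite -addrA -e6D.
apply: eq_bigr => j _; rewrite nth_rcons sz ltn_ord /bump /= -addrA -e6D add0n.
by rewrite -[(5 + _)%N]/(6 + j)%N -(e6_mod (6 + j)) modnDl e6_mod.
Qed.

Lemma vec_sum_rot i m : size m = 6 -> vec_sum (rot i m) = vec_sum m.
Proof.
move=> sz; case: (leqP i 6) => [i6|/ltnW i6]; last by rewrite rot_oversize ?sz.
elim: i i6 => [|i IH] i6; first by rewrite rot0.
by rewrite rotS ?sz // vec_sum_rot1 ?size_rot // IH // ltnW.
Qed.

Lemma sum_words_orbits :
  \sum_(s <- zero_words) vec_sum (mult_vec s) =
  \sum_(i < 14) (nth 0%N [:: 6; 180; 180; 90; 120; 360; 360; 540; 180; 720; 720; 1080; 1080;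
    2160] i)%:R
    * vec_sum (nth [::] orbit_reps i).
Proof.
transitivity (\sum_(i <- orbit_indices) vec_sum (nth [::] orbit_reps i)).
  have := orbit_indices_lt; rewrite /orbit_indices big_map => /allP lt14; apply: eq_big_seq => s sW.
  have has_r : has (fun r0 => r0 \in [seq rot i (mult_vec s) | i <- iota 0 6]) orbit_reps.
    by rewrite has_find; exact: (lt14 _ (map_f (fun s0 => orbit_index (mult_vec s0)) sW)).
  have /mapP[i _ ->] := nth_find [::] has_r.
  by rewrite vec_sum_rot // size_map size_iota.
rewrite -orbit_counts; have := orbit_indices_lt; move: orbit_indices => L /allP L14.
transitivity (\sum_(a <- L) \sum_(i < 14) (a == i)%:R * vec_sum (nth [::] orbit_reps i)).
  apply: eq_big_seq => a /L14 a14; rewrite (bigD1 (Ordinal a14)) //= eqxx mul1r.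
  rewrite big1 ?addr0 // => i ia; have -> : (a == i) = false; last by rewrite mul0r.
  by apply/negbTE; apply: contra ia => /eqP ai; apply/eqP/val_inj.
rewrite exchange_big; apply: eq_bigr => i _.
rewrite (nth_map 0%N) ?size_iota // nth_iota // add0n -mulr_suml; congr (_ * _).
by rewrite -sum1_count natr_sum [RHS]big_mkcond; apply: eq_bigr => a _ /=; case: eqP.
Qed.

Lemma X6_points_orbits :
  (X6_points lam)%:R = (q ^+ 5 - 1) / (q - 1) +
    q ^+ 2 * g h / (6%:R * nC) * \sum_(s <- zero_words) vec_sum (mult_vec s).
Proof.
have E : q * (1 + nC * (X6_points lam)%:R)
  = q ^+ 6 + (6%:R * (g h ^+ 3 * q))^-1 * (q ^+ 6 * \sum_(s <- zero_words) vec_sum (mult_vec s)).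
  rewrite -X6_points_affine word_formula; congr (_ + _ * _).
  under [in RHS]eq_bigr do rewrite vec_sum_mult.
  rewrite exchange_big mulr_sumr; apply: eq_bigr => k _ /=.
  by rewrite -mulr_sumr mulrCA.
move: (\sum_(s <- _) _) E => T E.
have g0 : g h != 0 := gauss_neq0 h.
have six0 : 6%:R != 0 :> algC by rewrite pnatr_eq0.
have q1 : q - 1 = nC by rewrite qE addrK.
apply: (mulfI (mulf_neq0 q_neq0 n_neq0)); rewrite q1.
have -> : q * nC * (X6_points lam)%:R = q * (1 + nC * (X6_points lam)%:R) - q by ring.
(* The square of g(h) is q up to sign, so 1 / g(h)^3 can be traded for g(h) / q^2. *)
have g4 : g h ^+ 3 * g h = q ^+ 2.
  rewrite -exprSr (exprM _ 2 2) gauss_eta_sqr exprMn expr2 w_m1_sqr mul1r //.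
have C3 : g h ^+ 3 * q = q ^+ 3 / g h by apply: (mulIf g0); rewrite divfK // mulrAC g4; ring.
rewrite C3 in E; rewrite E; move: n_neq0 q_neq0; move: nC q => N Q N0 Q0.
by field; rewrite N0 Q0 g0.
Qed.

(** * Greene's functions in terms of Gauss sums *)

Lemma chmul_w a b : chmul (w a) (w b) = w (a + b).
Proof. by apply/funext => x; rewrite /chmul wD. Qed.

Lemma chbar_w a : chbar (w a) = w (- a).
Proof. by apply/funext => x; rewrite /chbar w_conj. Qed.

Lemma eps_w : @eps F = w 0.
Proof. by apply/funext => x; rewrite /eps w_00; case: eqP. Qed.

Lemma J2_gauss_neq0 a b : (a != 0) || (b != 0) ->
  q * J2 (w a) (w b) = w (a + b) (-1) * g (- (a + b)) * g a * g b.
Proof.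
rewrite J2_gauss => /orP[] /negPf ->; by rewrite ?mulr0 ?mul0r add0r.
Qed.

(** As a - b is nontrivial, the only degenerate case is b = 0, which [corr b] records; all signs
    square to 1. *)
Lemma binom_gauss a b : a != b -> binom (w a) (w b) = g a * (corr b / g b) / g (a - b).
Proof.
move=> ab; have ab0 : a - b != 0 by rewrite subr_eq0.
have ab' : (a != 0) || (- b != 0).
  by rewrite oppr_eq0 -negb_and; apply: contra ab => /andP[/eqP-> /eqP->].
rewrite /binom chbar_w; apply: (mulfI q_neq0).
rewrite mulrCA J2_gauss_neq0 // !gauss_opp corr1 // wD wN_m1.
transitivity ((w a (-1) * w a (-1)) * (w b (-1) * w b (-1)) * (w b (-1) * w b (-1)) * (q * (g a *
  (corr b / g b) / g (a - b)))).
  by field; rewrite q_neq0 !gauss_neq0.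
by rewrite !w_m1_sqr !mul1r.
Qed.

Lemma mellin_inversion (f : F -> algC) u : u != 0 ->
  nC * f u = \sum_k w k u * mellin f (- k).
Proof.
move=> u0; transitivity (\sum_z f z * \sum_k w k (u / z)).
  under eq_bigr do rewrite sum_w_k.
  rewrite (bigD1 u) //= divff // eqxx big1 ?addr0 => [|z zu]; first by rewrite mulr1 mulrC.
  have [->|z0] := eqVneq z 0; first by rewrite invr0 mulr0 eq_sym oner_eq0 !mulr0.
  by rewrite -[_ == 1](inj_eq (mulIf z0)) divfK // mul1r eq_sym (negPf zu) !mulr0.
under eq_bigr do rewrite mulr_sumr.
rewrite exchange_big; apply: eq_bigr => k _ /=; rewrite mulr_sumr.
by apply: eq_bigr => z _; rewrite wM wNV; ring.
Qed.

Lemma binom_J2 a k : a != 0 -> q * binom (w (a + k)) (w k) = J2 (w (- k)) (w (- a)).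
Proof.
move=> a0; rewrite binom_gauss ?addrK; last by rewrite -subr_eq0 addrK.
apply: (mulfI q_neq0); rewrite J2_gauss_neq0 ?oppr_eq0 ?a0 ?orbT //.
rewrite -opprD opprK !gauss_opp (corr1 a0) wN_m1 wD [k + a]addrC.
transitivity ((w a (-1) * w a (-1)) * (w k (-1) * w k (-1)) * (q * (q * (g (a
  + k) * (corr k / g k) / g a)))); last by ring.
by rewrite !w_m1_sqr !mul1r.
Qed.

(** Greene's binomial theorem: Mellin inversion of the function on the left, whose transform is a
    Jacobi sum. *)
Lemma w_eq_sum_binom a u : a != 0 -> u != 0 ->
  nC * w (- a) (1 - u) = q * \sum_k binom (w (a + k)) (w k) * w k u.
Proof.
move=> a0 u0; rewrite (mellin_inversion (fun z => w (- a) (1 - z)) u0) mulr_sumr.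
by apply: eq_bigr => k _; rewrite mulrA binom_J2 // mulrC.
Qed.

(** The last character in the sum over y is expanded by the binomial theorem, after which the sum
    over y is the Jacobi sum of the second binomial coefficient. So 2F1 falls under [vec_sum_Greene]
    too. *)
Lemma Greene21_GreeneF a0 a1 b1 x : x != 0 -> a0 != 0 -> a1 != b1 ->
  Greene21 (w a0) (w a1) (w b1) x = GreeneF (w a0) [:: w a1] [:: w b1] x.
Proof.
move=> x0 a00 ab; have ab0 : a1 - b1 != 0 by rewrite subr_eq0.
have ba0 : b1 - a1 != 0 by rewrite subr_eq0 eq_sym.
have binom1 k : q * binom (w (a1 + k)) (w (b1 + k)) =
    w a1 (-1) * w b1 (-1) * J2 (w (a1 + k)) (w (b1 - a1)).
  rewrite binom_gauss; last by rewrite (inj_eq (addIr k)).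
  have -> : a1 + k - (b1 + k) = a1 - b1 by ring.
  apply: (mulfI q_neq0); rewrite [RHS]mulrCA J2_gauss_neq0 ?ba0 ?orbT //.
  have -> : a1 + k + (b1 - a1) = b1 + k by ring.
  rewrite -[b1 - a1]opprB !gauss_opp (corr1 ab0) !wD wN_m1.
  transitivity ((w a1 (-1) * w a1 (-1)) * (w b1 (-1) * w b1 (-1)) * (w b1 (-1) * w b1 (-1)) * (w
    k (-1) * w k (-1))
     * (q * (q * (g (a1 + k) * (corr (b1 + k) / g (b1 + k)) / g (a1 - b1))))); last by ring.
  by rewrite !w_m1_sqr !mul1r.
rewrite /Greene21 /GreeneF sum_mchars /eps (negPf x0) mul1r !chbar_w chmul_w.
have q1 : q - 1 = nC by rewrite qE addrK.
rewrite q1; apply: (mulfI n_neq0); rewrite mulrCA mulr_sumr.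
transitivity (w a1 (-1) * w b1 (-1) / q * \sum_y \sum_k w a1 y * w (b1 - a1) (1 - y) * (q *
  (binom (w (a0 + k)) (w k) * w k (x * y)))).
  congr (_ * _); apply: eq_bigr => y _.
  have [->|y0] := eqVneq y 0.
    by rewrite w0x !mul0r mulr0 big1 // => k _; rewrite !mul0r.
  by rewrite mulrCA w_eq_sum_binom ?mulf_neq0 // -!mulr_sumr addrC.
have cancelN (N a b : algC) : N != 0 -> N * (a / N * b) = a * b by move=> N0; field.
rewrite exchange_big !mulr_sumr; apply: eq_bigr => k _ /=.
rewrite !chmul_w big_seq1 /= !chmul_w.
have := binom1 k; rewrite /J2 mulr_sumr => binom1k.
transitivity (binom (w (a0 + k)) (w k) * w k x * (q * binom (w (a1 + k)) (w (b1 + k)))).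
  2: by rewrite [RHS]cancelN ?n_neq0 //; ring.
rewrite binom1k !mulr_sumr; apply: eq_bigr => y _.
by rewrite wM (wD a1 k); field; rewrite q_neq0.
Qed.

Local Notation X := (lam ^+ 6)^-1.

(* Each triple (i, j, d) of [ijs] stands for an upper parameter [e6 i] above a lower
   parameter [e6 j], with difference [e6 d]; the leading lower parameter is trivial. *)
Lemma vec_sum_Greene (i0 : nat) (ijs : seq (nat * nat * nat)) (m : seq nat) :
  (i0 %% 6 != 0)%N ->
  all (fun ij => [&& ij.1.2 <= 6,
    ij.2 %% 6 != 0 & (ij.1.1 + (6 - ij.1.2)) %% 6 == ij.2 %% 6])%N ijs ->
  (forall k, \prod_(j < 6) local_factor (k + e6 j) (nth 0%N m j) =
     g (k + e6 i0) * (corr (k + e6 0) / g (k + e6 0)) *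
     \prod_(ij <- ijs) (g (k + e6 ij.1.1) * (corr (k + e6 ij.1.2) / g (k + e6 ij.1.2)))) ->
  vec_sum m = nC / q * (g (e6 i0) * \prod_(ij <- ijs) g (e6 ij.2)) *
    GreeneF (w (e6 i0)) [seq w (e6 ij.1.1) | ij <- ijs] [seq w (e6 ij.1.2) | ij <- ijs] X.
Proof.
move=> i0n0 ijsP mE; have q1 : q - 1 = nC by rewrite qE addrK.
have cancel (N Q c T : algC) : N != 0 -> Q != 0 -> N / Q * c * (Q / N * T) = c * T.
  by move=> N0 Q0; field; rewrite N0 Q0.
rewrite /GreeneF sum_mchars q1 cancel ?n_neq0 ?q_neq0 // mulr_sumr; apply: eq_bigr => k _.
rewrite mE zip_map big_map chmul_w binom_gauss; last by rewrite -subr_eq0 addrK e6_eq0.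
rewrite addrK addr0; set P := \prod_(ij <- ijs) g _; set B := \prod_(ij <- ijs) binom _ _.
suff -> : \prod_(ij <- ijs) (g (k + e6 ij.1.1) * (corr (k + e6 ij.1.2) / g (k + e6 ij.1.2)))
  = P * B.
  by rewrite [e6 i0 + k]addrC; field; rewrite !gauss_neq0.
rewrite -big_split; apply: eq_big_seq => -[[i j] d] /(allP ijsP) /= /and3P[j6 d0 /eqP ijd].
rewrite !chmul_w; have eij : e6 i - e6 j = e6 d by rewrite e6N // -e6D -e6_mod ijd e6_mod.
have ekk : e6 i + k - (e6 j + k) = e6 i - e6 j by ring.
rewrite binom_gauss ?ekk ?eij; last by rewrite -subr_eq0 ekk eij e6_eq0.
by rewrite ![_ + k]addrC; field; rewrite !gauss_neq0.
Qed.

(** Letter 3 is missing and letter 0 is doubled, so a single binomial coefficient is left, and the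
    binomial theorem sums the series. *)
Lemma vec_sum_last :
  vec_sum [:: 2; 1; 1; 0; 1; 1]%N = nC / q * g h * eta (1 - X).
Proof.
have X0 : X != 0 by rewrite invr_eq0 expf_neq0.
have h0 : h != 0 by rewrite e6_eq0.
have := w_eq_sum_binom h0 X0; rewrite etaN -/eta => E.
transitivity (g h / q * (nC * eta (1 - X))); last by ring.
rewrite E mulrA divfK ?q_neq0 // mulr_sumr; apply: eq_bigr => k _.
rewrite !big_ord_recl big_ord0 /= /bump /= !expr0 e6_0 addr0 expr1.
rewrite binom_gauss; last by rewrite -subr_eq0 addrK.
by rewrite addrK [h + k]addrC; field; rewrite !gauss_neq0.
Qed.

Lemma e6_neq i j : (i < 6)%N -> (j < 6)%N -> i != j -> e6 i != e6 j.
Proof. by move=> i6 j6; apply: contra => /eqP /e6_inj ->. Qed.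

(** The fourth Gauss sum of [J3_gauss] is g(0) = -1, which is where the minus signs of the formula
    come from. *)
Lemma J3_sum0 i j l : ((i + j + l) %% 6 = 0)%N -> (i %% 6 != 0)%N ->
  q * J3 (w (e6 i)) (w (e6 j)) (w (e6 l)) = - (g (e6 i) * g (e6 j) * g (e6 l)).
Proof.
move=> s0 i0; have z : e6 (i + j + l) = 0 by rewrite -e6_mod s0.
rewrite J3_gauss e6_eq0 (negPf i0) -!e6D z oppr0 gauss0 w_00 oppr_eq0 oner_eq0.
by rewrite mulr0 !mul0r add0r mul1r !mulN1r !mulNr.
Qed.

(** * Assembly of the fourteen terms *)

Lemma X6_points_Greene : lam ^+ 6 != 1 ->
  let s := w (e6 1) (-1) in
  (X6_points lam)%:R =
    (q ^+ 5 - 1) / (q - 1)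
  + 360%:R * q ^+ 2 * eta (1 - lam ^+ 6)
  + q ^+ 4 * GreeneF (w (e6 1)) [:: w (e6 2); w (e6 3); w (e6 4); w (e6 5)]
      [:: w (e6 0); w (e6 0); w (e6 0); w (e6 0)] X
  + 30%:R * q ^+ 3 * s * GreeneF (w (e6 2)) [:: w (e6 3); w (e6 4)] [:: w (e6 0); w (e6 0)] X
  + 30%:R * q ^+ 3 * GreeneF (w (e6 1)) [:: w (e6 3); w (e6 5)] [:: w (e6 0); w (e6 0)] X
  - 15%:R * q ^+ 3 * s * J3 (w (e6 3)) (w (e6 4)) (w (e6 5))
      * GreeneF (w (e6 1)) [:: w (e6 5); w (e6 4); w (e6 2)] [:: w (e6 0); w (e6 0); w (e6 3)] X
  - 20%:R * q ^+ 3 * s * J3 (w (e6 1)) (w (e6 2)) (w (e6 3))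
      * GreeneF (w (e6 1)) [:: w (e6 3); w (e6 4); w (e6 5)] [:: w (e6 0); w (e6 2); w (e6 2)] X
  + 60%:R * q ^+ 2 * s * J3 (w (e6 1)) (w (e6 1)) (w (e6 4)) * J3 (w (e6 3)) (w (e6 4)) (w (e6 5))
      * GreeneF (w (e6 1)) [:: w (e6 4); w (e6 3)] [:: w (e6 0); w (e6 5)] X
  + 60%:R * q ^+ 2 * J3 (w (e6 2)) (w (e6 2)) (w (e6 2)) * J3 (w (e6 3)) (w (e6 4)) (w (e6 5))
      * GreeneF (w (e6 2)) [:: w (e6 5); w (e6 3)] [:: w (e6 0); w (e6 1)] X
  + 90%:R * q ^+ 3 * GreeneF (w (e6 3)) [:: w (e6 4); w (e6 5)] [:: w (e6 1); w (e6 2)] X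
  - 30%:R * q ^+ 2 * J2 (w (e6 1)) (w (e6 1)) * J3 (w (e6 1)) (w (e6 2)) (w (e6 3))
      * GreeneF (w (e6 1)) [:: w (e6 3); w (e6 5)] [:: w (e6 2); w (e6 4)] X
  - 120%:R * q ^+ 2 * J3 (w (e6 1)) (w (e6 2)) (w (e6 3))
      * Greene21 (w (e6 1)) (w (e6 2)) (w (e6 0)) X
  - 120%:R * q ^+ 2 * J3 (w (e6 3)) (w (e6 4)) (w (e6 5))
      * Greene21 (w (e6 4)) (w (e6 5)) (w (e6 0)) X
  - 180%:R * q ^+ 2 * J3 (w (e6 1)) (w (e6 2)) (w (e6 3))
      * Greene21 (w (e6 2)) (w (e6 4)) (w (e6 3)) X
  - 180%:R * q ^+ 2 * J3 (w (e6 1)) (w (e6 2)) (w (e6 3))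
      * Greene21 (w (e6 2)) (w (e6 5)) (w (e6 4)) X.
Proof.
move=> lam6 s.
have hs : eta (-1) = s by rewrite /eta (e6D 1 2) wD w_r_m1 mulr1.
have ss : s * s = 1 := w_m1_sqr _.
have G33 : g (e6 3) * g (e6 3) = s * q by rewrite -expr2 gauss_eta_sqr hs.
have G15 : g (e6 1) * g (e6 5) = s * q by rewrite -(@e6N 1) // gaussN e6_eq0 mulr0 subr0.
have G24 : g (e6 2) * g (e6 4) = q by rewrite -(@e6N 2) // gaussN e6_eq0 mulr0 subr0 w_r_m1 mul1r.
have J345 := @J3_sum0 3 4 5 erefl isT; have J123 := @J3_sum0 1 2 3 erefl isT.
have J114 := @J3_sum0 1 1 4 erefl isT; have J222 := @J3_sum0 2 2 2 erefl isT.
have J11 : q * J2 (w (e6 1)) (w (e6 1)) = g (e6 4) * g (e6 1) * g (e6 1).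
  by rewrite J2_gauss_neq0 ?e6_eq0 // -e6D w_r_m1 e6N // mul1r.
have last_eta : eta (1 - X) = s * eta (1 - lam ^+ 6).
  rewrite (_ : 1 - X = -1 * (lam^-1 ^+ 3) ^+ 2 * (1 - lam ^+ 6)); last by field.
  rewrite -mulrA etaM [eta (_ * (1 - lam ^+ 6))]etaM hs eta_sqr ?mul1r //.
  by rewrite expf_neq0 ?invr_eq0.
have X0 : X != 0 by rewrite invr_eq0 expf_neq0.
rewrite !Greene21_GreeneF ?e6_eq0 ?e6_neq //.
(* The factor 6 in each orbit count cancels the 6 in the denominator of [X6_points_orbits]. *)
have coef (M N : nat) c d V G : V = nC / q * c * G -> M = (6 * N)%N -> q * g (e6 3) * c = d ->
    q ^+ 2 * g (e6 3) / (6%:R * nC) * (M%:R * V) = N%:R * d * G.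
  move=> -> -> <-; rewrite (natrM _ 6 N); move: n_neq0 q_neq0; move: nC => Nn Nn0 q0.
  by field; rewrite q0 Nn0.
(* In [V0] to [V12], a position of multiplicity zero is an upper parameter, and a position of
   multiplicity m >= 1 is a lower one repeated m - 1 times. *)
have V0 : vec_sum [:: 6; 0; 0; 0; 0; 0]%N =
    nC / q * (g (e6 1) * (g (e6 2) * (g (e6 3) * (g (e6 4) * g (e6 5))))) *
    GreeneF (w (e6 1)) [:: w (e6 2); w (e6 3); w (e6 4); w (e6 5)] [:: w (e6 0); w (e6 0);
      w (e6 0); w (e6 0)] X.
  rewrite (@vec_sum_Greene 1 [:: (2, 0, 2); (3, 0, 3); (4, 0, 4);
    (5, 0, 5)]) ?big_cons ?big_nil ?mulr1 // => k.
  by rewrite !big_ord_recl big_ord0 !big_cons big_nil /bump /= ?expr0 ?expr1; ring.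
have V1 : vec_sum [:: 4; 1; 0; 0; 0; 1]%N =
    nC / q * (g (e6 2) * (g (e6 3) * g (e6 4))) *
    GreeneF (w (e6 2)) [:: w (e6 3); w (e6 4)] [:: w (e6 0); w (e6 0)] X.
  rewrite (@vec_sum_Greene 2 [:: (3, 0, 3); (4, 0, 4)]) ?big_cons ?big_nil ?mulr1 // => k.
  by rewrite !big_ord_recl big_ord0 !big_cons big_nil /bump /= ?expr0 ?expr1; ring.
have V2 : vec_sum [:: 4; 0; 1; 0; 1; 0]%N =
    nC / q * (g (e6 1) * (g (e6 3) * g (e6 5))) *
    GreeneF (w (e6 1)) [:: w (e6 3); w (e6 5)] [:: w (e6 0); w (e6 0)] X.
  rewrite (@vec_sum_Greene 1 [:: (3, 0, 3); (5, 0, 5)]) ?big_cons ?big_nil ?mulr1 // => k.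
  by rewrite !big_ord_recl big_ord0 !big_cons big_nil /bump /= ?expr0 ?expr1; ring.
have V3 : vec_sum [:: 4; 0; 0; 2; 0; 0]%N =
    nC / q * (g (e6 1) * (g (e6 5) * (g (e6 4) * g (e6 5)))) *
    GreeneF (w (e6 1)) [:: w (e6 5); w (e6 4); w (e6 2)] [:: w (e6 0); w (e6 0); w (e6 3)] X.
  rewrite (@vec_sum_Greene 1 [:: (5, 0, 5); (4, 0, 4);
    (2, 3, 5)]) ?big_cons ?big_nil ?mulr1 // => k.
  by rewrite !big_ord_recl big_ord0 !big_cons big_nil /bump /= ?expr0 ?expr1; ring.
have V4 : vec_sum [:: 3; 0; 3; 0; 0; 0]%N =
    nC / q * (g (e6 1) * (g (e6 3) * (g (e6 2) * g (e6 3)))) *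
    GreeneF (w (e6 1)) [:: w (e6 3); w (e6 4); w (e6 5)] [:: w (e6 0); w (e6 2); w (e6 2)] X.
  rewrite (@vec_sum_Greene 1 [:: (3, 0, 3); (4, 2, 2);
    (5, 2, 3)]) ?big_cons ?big_nil ?mulr1 // => k.
  by rewrite !big_ord_recl big_ord0 !big_cons big_nil /bump /= ?expr0 ?expr1; ring.
have V5 : vec_sum [:: 3; 0; 1; 0; 0; 2]%N =
    nC / q * (g (e6 1) * (g (e6 4) * g (e6 4))) *
    GreeneF (w (e6 1)) [:: w (e6 4); w (e6 3)] [:: w (e6 0); w (e6 5)] X.
  rewrite (@vec_sum_Greene 1 [:: (4, 0, 4); (3, 5, 4)]) ?big_cons ?big_nil ?mulr1 // => k.
  by rewrite !big_ord_recl big_ord0 !big_cons big_nil /bump /= ?expr0 ?expr1; ring.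
have V6 : vec_sum [:: 3; 2; 0; 0; 1; 0]%N =
    nC / q * (g (e6 2) * (g (e6 5) * g (e6 2))) *
    GreeneF (w (e6 2)) [:: w (e6 5); w (e6 3)] [:: w (e6 0); w (e6 1)] X.
  rewrite (@vec_sum_Greene 2 [:: (5, 0, 5); (3, 1, 2)]) ?big_cons ?big_nil ?mulr1 // => k.
  by rewrite !big_ord_recl big_ord0 !big_cons big_nil /bump /= ?expr0 ?expr1; ring.
have V7 : vec_sum [:: 2; 2; 2; 0; 0; 0]%N =
    nC / q * (g (e6 3) * (g (e6 3) * g (e6 3))) *
    GreeneF (w (e6 3)) [:: w (e6 4); w (e6 5)] [:: w (e6 1); w (e6 2)] X.
  rewrite (@vec_sum_Greene 3 [:: (4, 1, 3); (5, 2, 3)]) ?big_cons ?big_nil ?mulr1 // => k.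
  by rewrite !big_ord_recl big_ord0 !big_cons big_nil /bump /= ?expr0 ?expr1; ring.
have V8 : vec_sum [:: 2; 0; 2; 0; 2; 0]%N =
    nC / q * (g (e6 1) * (g (e6 1) * g (e6 1))) *
    GreeneF (w (e6 1)) [:: w (e6 3); w (e6 5)] [:: w (e6 2); w (e6 4)] X.
  rewrite (@vec_sum_Greene 1 [:: (3, 2, 1); (5, 4, 1)]) ?big_cons ?big_nil ?mulr1 // => k.
  by rewrite !big_ord_recl big_ord0 !big_cons big_nil /bump /= ?expr0 ?expr1; ring.
have V9 : vec_sum [:: 3; 0; 0; 1; 1; 1]%N =
    nC / q * (g (e6 1) * g (e6 2)) *
    GreeneF (w (e6 1)) [:: w (e6 2)] [:: w (e6 0)] X.
  rewrite (@vec_sum_Greene 1 [:: (2, 0, 2)]) ?big_cons ?big_nil ?mulr1 // => k.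
  by rewrite !big_ord_recl big_ord0 !big_cons big_nil /bump /= ?expr0 ?expr1; ring.
have V10 : vec_sum [:: 3; 1; 1; 1; 0; 0]%N =
    nC / q * (g (e6 4) * g (e6 5)) *
    GreeneF (w (e6 4)) [:: w (e6 5)] [:: w (e6 0)] X.
  rewrite (@vec_sum_Greene 4 [:: (5, 0, 5)]) ?big_cons ?big_nil ?mulr1 // => k.
  by rewrite !big_ord_recl big_ord0 !big_cons big_nil /bump /= ?expr0 ?expr1; ring.
have V11 : vec_sum [:: 2; 1; 0; 2; 0; 1]%N =
    nC / q * (g (e6 2) * g (e6 1)) *
    GreeneF (w (e6 2)) [:: w (e6 4)] [:: w (e6 3)] X.
  rewrite (@vec_sum_Greene 2 [:: (4, 3, 1)]) ?big_cons ?big_nil ?mulr1 // => k.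
  by rewrite !big_ord_recl big_ord0 !big_cons big_nil /bump /= ?expr0 ?expr1; ring.
have V12 : vec_sum [:: 2; 1; 0; 1; 2; 0]%N =
    nC / q * (g (e6 2) * g (e6 1)) *
    GreeneF (w (e6 2)) [:: w (e6 5)] [:: w (e6 4)] X.
  rewrite (@vec_sum_Greene 2 [:: (5, 4, 1)]) ?big_cons ?big_nil ?mulr1 // => k.
  by rewrite !big_ord_recl big_ord0 !big_cons big_nil /bump /= ?expr0 ?expr1; ring.
(* [K0] to [K13] rewrite the Gauss sums of each class: pairs of opposite exponents give q up to
   sign, and triples of zero sum give Jacobi sums. *)
have K0 : q * g (e6 3) * (g (e6 1) * (g (e6 2) * (g (e6 3) * (g (e6 4) * g (e6 5))))) = q ^+ 4.
  transitivity (q * (g (e6 3) * g (e6 3)) * (g (e6 1) * g (e6 5)) * (g (e6 2) * g (e6 4)));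
    first by ring.
  rewrite G33 G15 G24.
  transitivity (s * s * q ^+ 4); last by rewrite ss; ring.
  by ring.
have K1 : q * g (e6 3) * (g (e6 2) * (g (e6 3) * g (e6 4))) = q ^+ 3 * s.
  transitivity (q * (g (e6 3) * g (e6 3)) * (g (e6 2) * g (e6 4))); first by ring.
  rewrite G33 G24.
  transitivity (q ^+ 3 * s); last by ring.
  by ring.
have K2 : q * g (e6 3) * (g (e6 1) * (g (e6 3) * g (e6 5))) = q ^+ 3.
  transitivity (q * (g (e6 3) * g (e6 3)) * (g (e6 1) * g (e6 5))); first by ring.
  rewrite G33 G15.
  transitivity (s * s * q ^+ 3); last by rewrite ss; ring.
  by ring.
have K3 : q * g (e6 3) * (g (e6 1) * (g (e6 5) * (g (e6 4) * g (e6 5))))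
  = - (q ^+ 3 * s * J3 (w (e6 3)) (w (e6 4)) (w (e6 5))).
  transitivity (q * (g (e6 1) * g (e6 5)) * (g (e6 3) * g (e6 4) * g (e6 5))); first by ring.
  rewrite G15.
  transitivity (- (q ^+ 2 * s * (q * J3 (w (e6 3)) (w (e6 4)) (w (e6 5))))); last by ring.
  rewrite J345.
  by ring.
have K4 : q * g (e6 3) * (g (e6 1) * (g (e6 3) * (g (e6 2) * g (e6 3))))
  = - (q ^+ 3 * s * J3 (w (e6 1)) (w (e6 2)) (w (e6 3))).
  transitivity (q * (g (e6 3) * g (e6 3)) * (g (e6 1) * g (e6 2) * g (e6 3))); first by ring.
  rewrite G33.
  transitivity (- (q ^+ 2 * s * (q * J3 (w (e6 1)) (w (e6 2)) (w (e6 3))))); last by ring.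
  rewrite J123.
  by ring.
have K5 : q * g (e6 3) * (g (e6 1) * (g (e6 4) * g (e6 4)))
  = q ^+ 2 * s * J3 (w (e6 1)) (w (e6 1)) (w (e6 4)) * J3 (w (e6 3)) (w (e6 4)) (w (e6 5)).
  transitivity (q * (g (e6 3) * g (e6 1) * g (e6 4) * g (e6 4))); first by ring.
  transitivity (s * (q * J3 (w (e6 1)) (w (e6 1)) (w (e6 4))) * (q * J3 (w (e6 3)) (w (e6 4)) (w
    (e6 5)))); last by ring.
  rewrite J114 J345.
  (* The Jacobi sums contain the extra pair g(e6 1) g(e6 5) = s q, whose sign cancels the prefactor
     [s]. *)
  transitivity (s * (g (e6 1) * g (e6 5)) * (g (e6 3) * g (e6 1) * g (e6 4) * g (e6 4)));
    last by ring.
  rewrite G15.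
  transitivity (s * s * (q * (g (e6 3) * g (e6 1) * g (e6 4) * g (e6 4)))); last by ring.
  by rewrite ss; ring.
have K6 : q * g (e6 3) * (g (e6 2) * (g (e6 5) * g (e6 2)))
  = q ^+ 2 * J3 (w (e6 2)) (w (e6 2)) (w (e6 2)) * J3 (w (e6 3)) (w (e6 4)) (w (e6 5)).
  transitivity (q * (g (e6 3) * g (e6 2) * g (e6 5) * g (e6 2))); first by ring.
  transitivity ((q * J3 (w (e6 2)) (w (e6 2)) (w (e6 2))) * (q * J3 (w (e6 3)) (w (e6 4)) (w (e6 5)))); last by ring.
  rewrite J222 J345.
  transitivity ((g (e6 2) * g (e6 4)) * (g (e6 3) * g (e6 2) * g (e6 5) * g (e6 2))); last by ring.
  rewrite G24.
  by ring.
have K7 : q * g (e6 3) * (g (e6 3) * (g (e6 3) * g (e6 3))) = q ^+ 3.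
  transitivity (q * (g (e6 3) * g (e6 3)) * (g (e6 3) * g (e6 3))); first by ring.
  rewrite G33.
  transitivity (s * s * q ^+ 3); last by rewrite ss; ring.
  by ring.
have K8 : q * g (e6 3) * (g (e6 1) * (g (e6 1) * g (e6 1)))
  = - (q ^+ 2 * J2 (w (e6 1)) (w (e6 1)) * J3 (w (e6 1)) (w (e6 2)) (w (e6 3))).
  transitivity (q * (g (e6 3) * g (e6 1) * g (e6 1) * g (e6 1))); first by ring.
  transitivity (- ((q * J2 (w (e6 1)) (w (e6 1))) * (q * J3 (w (e6 1)) (w (e6 2)) (w (e6 3)))));
    last by ring.
  rewrite J11 J123.
  transitivity ((g (e6 2) * g (e6 4)) * (g (e6 3) * g (e6 1) * g (e6 1) * g (e6 1))); last by ring.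
  rewrite G24.
  by ring.
have K9 : q * g (e6 3) * (g (e6 1) * g (e6 2)) = - (q ^+ 2 * J3 (w (e6 1)) (w (e6 2)) (w (e6 3))).
  transitivity (q * (g (e6 1) * g (e6 2) * g (e6 3))); first by ring.
  transitivity (- (q * (q * J3 (w (e6 1)) (w (e6 2)) (w (e6 3))))); last by ring.
  rewrite J123.
  by ring.
have K10 : q * g (e6 3) * (g (e6 4) * g (e6 5)) = - (q ^+ 2 * J3 (w (e6 3)) (w (e6 4)) (w (e6 5))).
  transitivity (q * (g (e6 3) * g (e6 4) * g (e6 5))); first by ring.
  transitivity (- (q * (q * J3 (w (e6 3)) (w (e6 4)) (w (e6 5))))); last by ring.
  rewrite J345.
  by ring.
have K11 : q * g (e6 3) * (g (e6 2) * g (e6 1)) = - (q ^+ 2 * J3 (w (e6 1)) (w (e6 2)) (w (e6 3))).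
  transitivity (q * (g (e6 1) * g (e6 2) * g (e6 3))); first by ring.
  transitivity (- (q * (q * J3 (w (e6 1)) (w (e6 2)) (w (e6 3))))); last by ring.
  rewrite J123.
  by ring.
have K12 : q * g (e6 3) * (g (e6 2) * g (e6 1)) = - (q ^+ 2 * J3 (w (e6 1)) (w (e6 2)) (w (e6 3))).
  transitivity (q * (g (e6 1) * g (e6 2) * g (e6 3))); first by ring.
  transitivity (- (q * (q * J3 (w (e6 1)) (w (e6 2)) (w (e6 3))))); last by ring.
  rewrite J123.
  by ring.
have K13 : q * g (e6 3) * g (e6 3) = q ^+ 2 * s.
  by rewrite -mulrA G33; ring.
rewrite X6_points_orbits sum_words_orbits mulr_sumr /orbit_reps !big_ord_recl big_ord0 /=.
rewrite (coef 6%N 1%N _ _ _ _ V0 erefl K0).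
rewrite (coef 180%N 30%N _ _ _ _ V1 erefl K1).
rewrite (coef 180%N 30%N _ _ _ _ V2 erefl K2).
rewrite (coef 90%N 15%N _ _ _ _ V3 erefl K3).
rewrite (coef 120%N 20%N _ _ _ _ V4 erefl K4).
rewrite (coef 360%N 60%N _ _ _ _ V5 erefl K5).
rewrite (coef 360%N 60%N _ _ _ _ V6 erefl K6).
rewrite (coef 540%N 90%N _ _ _ _ V7 erefl K7).
rewrite (coef 180%N 30%N _ _ _ _ V8 erefl K8).
rewrite (coef 720%N 120%N _ _ _ _ V9 erefl K9).
rewrite (coef 720%N 120%N _ _ _ _ V10 erefl K10).
rewrite (coef 1080%N 180%N _ _ _ _ V11 erefl K11).
rewrite (coef 1080%N 180%N _ _ _ _ V12 erefl K12).
rewrite (coef 2160%N 360%N _ _ _ _ vec_sum_last erefl K13) last_eta.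
have -> : 360%:R * (q ^+ 2 * s) * (s * eta (1 - lam ^+ 6))
  = (s * s) * (360%:R * q ^+ 2 * eta (1 - lam ^+ 6)) by ring.
rewrite ss; ring.
Qed.
End Points.
End MultChar.

(** * The formula in terms of powers of omega and their conjugates *)

Theorem theorem1p3 (F : finFieldType) (omega : ch F) (lam : F) :
  (#|F| %% 6 = 1)%N ->
  is_mchar omega ->
  (forall chi : ch F, is_mchar chi -> exists k : nat, chi = chpow omega k) ->
  lam != 0 -> lam ^+ 6 != 1 ->
  let q := qF F in
  let t := ((#|F| - 1) %/ 6)%N in
  let w6 := chpow omega t in
  let w3 := chpow omega (2 * t) in
  let w2 := chpow omega (3 * t) in
  let bw6 := chbar w6 in
  let bw3 := chbar w3 in
  let e : ch F := eps (F:=F) in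
  let x := (lam ^+ 6)^-1 in
  (X6_points lam)%:R =
    (q ^+ 5 - 1) / (q - 1)
  + 360%:R * q ^+ 2 * w2 (1 - lam ^+ 6)
  + q ^+ 4 * GreeneF w6 [:: w3; w2; bw3; bw6] [:: e; e; e; e] x
  + 30%:R * q ^+ 3 * w6 (-1) * GreeneF w3 [:: w2; bw3] [:: e; e] x
  + 30%:R * q ^+ 3 * GreeneF w6 [:: w2; bw6] [:: e; e] x
  - 15%:R * q ^+ 3 * w6 (-1) * J3 w2 bw3 bw6
      * GreeneF w6 [:: bw6; bw3; w3] [:: e; e; w2] x
  - 20%:R * q ^+ 3 * w6 (-1) * J3 w6 w3 w2
      * GreeneF w6 [:: w2; bw3; bw6] [:: e; w3; w3] x
  + 60%:R * q ^+ 2 * w6 (-1) * J3 w6 w6 bw3 * J3 w2 bw3 bw6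
      * GreeneF w6 [:: bw3; w2] [:: e; bw6] x
  + 60%:R * q ^+ 2 * J3 w3 w3 w3 * J3 w2 bw3 bw6
      * GreeneF w3 [:: bw6; w2] [:: e; w6] x
  + 90%:R * q ^+ 3 * GreeneF w2 [:: bw3; bw6] [:: w6; w3] x
  - 30%:R * q ^+ 2 * J2 w6 w6 * J3 w6 w3 w2
      * GreeneF w6 [:: w2; bw6] [:: w3; bw3] x
  - 120%:R * q ^+ 2 * J3 w6 w3 w2 * Greene21 w6 w3 e x
  - 120%:R * q ^+ 2 * J3 w2 bw3 bw6 * Greene21 bw3 bw6 e x
  - 180%:R * q ^+ 2 * J3 w6 w3 w2 * Greene21 w3 bw3 w2 x
  - 180%:R * q ^+ 2 * J3 w6 w3 w2 * Greene21 w3 bw6 bw3 x.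
Proof.
move=> card6 omegaP omega_gen lam0 lam6 q t w6 w3 w2 bw6 bw3 e x.
have cardF : #|F| = (6 * t).+1 by rewrite /t {1}(divn_eq #|F| 6) card6; lia.
have [psi [psiD psi_neq0 sum_psi]] := exists_additive_char F.
have wE j : chpow omega (j * t) = w omega (e6 t j) := chpow_natr cardF omegaP _.
have w6E : w6 = w omega (e6 t 1) by rewrite -wE mul1n.
have w3E : w3 = w omega (e6 t 2) := wE 2.
have w2E : w2 = w omega (e6 t 3) := wE 3.
have bw6E : bw6 = w omega (e6 t 5) by rewrite /bw6 w6E (chbar_w cardF omegaP) (e6N cardF).
have bw3E : bw3 = w omega (e6 t 4) by rewrite /bw3 w3E (chbar_w cardF omegaP) (e6N cardF).
have eE : e = w omega (e6 t 0) by rewrite /e (eps_w omega t).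
rewrite bw6E bw3E w6E w3E w2E eE.
exact: (X6_points_Greene cardF omegaP omega_gen psiD psi_neq0 sum_psi lam0 lam6).
Qed.
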